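(* Let $T>0$, let $m\ge 1$, let $\alpha_0>\alpha_1>\cdots>\alpha_m\ge 0$ be real numbers, let $n_0$ be the integer with $n_0-1<\alpha_0\le n_0$, and let $\gamma=n_0-\alpha_0$ with $0<\gamma<1$. Assume that $a_i\in C^1_\gamma[0,T]$ for $i=1,\dots,m$ and that $H_{n_0-1}:=\{i\in\{1,\dots,m\}:0\le\alpha_i\le n_0-1\}=\emptyset$. Let $b_0,\dots,b_{n_0-1}\in\mathbb R$. Then the initial value problem $${}^cD_{0+}^{\alpha_0}y(t)=-\sum_{i=1}^m a_i(t)\,{}^cD_{0+}^{\alpha_i}y(t),\quad 0<t<T;\qquad D^ky(t)|_{t=+0}=b_k,\quad k=0,1,\dots,n_0-1,$$ has a unique solution $y\in C_\gamma^{n_0}[0,T]$, and it is represented as $y(t)=\sum_{j=0}^{n_0-1}b_jy_j(t)$, where $y_j(t)=\Phi_{j+1}(t)=t^j/j!$, $y_j\in C^\infty[0,T]$, $j=0,1,\dots,n_0-1$, is the canonical fundamental system of solutions of the equation ${}^cD_{0+}^{\alpha_0}y(t)=-\sum_{i=1}^m a_i(t)\,{}^cD_{0+}^{\alpha_i}y(t)$, $0<t<T$.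
   Context: All functions are real valued. For $0\le\gamma<1$, $C_\gamma[0,T]$ is the space of functions $f$ on $(0,T]$ such that $t\mapsto t^\gamma f(t)$ belongs to $C[0,T]$ (i.e. extends continuously to $[0,T]$). For $n\in\mathbb N$, $C^n_\gamma[0,T]$ is the space of functions $f$ that are $n-1$ times continuously differentiable on $[0,T]$ and have an $n$-th derivative $f^{(n)}\in C_\gamma[0,T]$. Riemann–Liouville integral: $I_{0+}^\alpha f(t)=\frac1{\Gamma(\alpha)}\int_0^t(t-\tau)^{\alpha-1}f(\tau)\,d\tau$ for $\alpha>0$, and $I^0_{0+}f=f$. Riemann–Liouville derivative: for $n-1<\alpha\le n$, $D_{0+}^\alpha f(t)=\frac{d^n}{dt^n}I_{0+}^{n-\alpha}f(t)$ for $t>0$. Caputo derivative: for $n-1<\alpha\le n$, ${}^cD_{0+}^\alpha f(t)=D_{0+}^\alpha\big[f(t)-\sum_{k=0}^{n-1}\frac{f^{(k)}(0)}{k!}t^k\big]$. $D^k=d^k/dt^k$. A canonical fundamental system of solutions of the equation is a system of solutions $y_0,\dots,y_{n_0-1}$ with $D^ky_j(t)|_{t=+0}=1$ if $k=j$ and $=0$ if $k\ne j$, for $k,j=0,1,\dots,n_0-1$. *)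

(* Defs.v *)
From HB Require Import structures.
From mathcomp Require Import all_boot all_order all_algebra.
From mathcomp Require Import all_classical all_reals all_analysis.

Set Implicit Arguments.
Unset Strict Implicit.
Unset Printing Implicit Defensive.

Import Order.TTheory GRing.Theory Num.Theory.
Import numFieldNormedType.Exports.

Local Open Scope classical_set_scope.
Local Open Scope ring_scope.

(* Functions on [0, T] or (0, T] are represented by
   total functions R -> R; the notions below only look at their values on that
   interval. *)

Section FractionalCalculus.
Context {R : realType}.
Implicit Types (f g y : R -> R) (A : set R) (T alpha gamma t : R).

(* Differentiation relative to a set: one-sided at the end points of an
   interval, the usual two-sided notion at its interior points. *)
Definition derivable_in A f t : Prop :=
  cvg ((f s - f t) / (s - t) @[s --> within A t^']).

Definition deriv_in A f t : R :=
  lim ((f s - f t) / (s - t) @[s --> within A t^']).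

Definition deriv_in_n A (n : nat) f : R -> R := iter n (deriv_in A) f.

Definition Cn T (n : nat) f : Prop :=
  (forall k, (k < n)%N ->
     forall t, 0 <= t <= T -> derivable_in `[0, T] (deriv_in_n `[0, T] k f) t) /\
  (forall k, (k <= n)%N ->
     {within `[0, T], continuous (deriv_in_n `[0, T] k f)}).

Definition Cinfty T f : Prop := forall n, Cn T n f.

Definition C_weighted gamma T f : Prop :=
  exists2 g : R -> R, {within `[0, T], continuous g} &
    forall t, 0 < t <= T -> g t = t `^ gamma * f t.

(* Meant for n >= 1. *)
Definition Cn_weighted gamma T (n : nat) f : Prop :=
  [/\ Cn T n.-1 f,
      forall t, 0 < t <= T -> derivable_in `[0, T] (deriv_in_n `[0, T] n.-1 f) t &
      C_weighted gamma T (deriv_in_n `[0, T] n f)].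

Definition Gamma (x : R) : R :=
  \int[lebesgue_measure]_(s in `]0, +oo[) (s `^ (x - 1) * expR (- s)).

Definition RL_integral alpha f t : R :=
  if alpha == 0 then f t
  else (Gamma alpha)^-1 *
       \int[lebesgue_measure]_(s in `]0, t[) ((t - s) `^ (alpha - 1) * f s).

(* For alpha >= 0, the natural number n with n - 1 < alpha <= n. *)
Definition frac_order alpha : nat := absz (Num.ceil alpha).

Definition RL_derivative alpha f : R -> R :=
  derive1n (frac_order alpha) (RL_integral ((frac_order alpha)%:R - alpha) f).

(* [derive1n] is total, hence the separate existence predicate, on (0, T). *)
Definition RL_derivable T alpha f : Prop :=
  forall k, (k < frac_order alpha)%N -> forall t, 0 < t < T ->
    derivable
      (derive1n k (RL_integral ((frac_order alpha)%:R - alpha) f)) t 1.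

(* f minus its Taylor polynomial at 0 of degree < n; the derivatives at 0 are
   right derivatives. *)
Definition taylor_rem T (n : nat) f t : R :=
  f t - \sum_(0 <= k < n) deriv_in_n `[0, T] k f 0 / k`!%:R * t ^+ k.

Definition caputo T alpha f : R -> R :=
  RL_derivative alpha (taylor_rem T (frac_order alpha) f).

Definition caputo_derivable T alpha f : Prop :=
  RL_derivable T alpha (taylor_rem T (frac_order alpha) f).

Definition fde_solution gamma T (m : nat) (alpha_ : nat -> R)
    (a : nat -> R -> R) y : Prop :=
  [/\ Cn_weighted gamma T (frac_order (alpha_ 0%N)) y,
      forall i, (i <= m)%N -> caputo_derivable T (alpha_ i) y &
      forall t, 0 < t < T ->
        caputo T (alpha_ 0%N) y t =
        - \sum_(1 <= i < m.+1) a i t * caputo T (alpha_ i) y t].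

Definition init_value T (k : nat) y (b : R) : Prop :=
  deriv_in_n `[0, T] k y t @[t --> 0^'+] --> b.

Definition canonical_fundamental_system gamma T (m : nat) (alpha_ : nat -> R)
    (a : nat -> R -> R) (n : nat) (Y : nat -> R -> R) : Prop :=
  forall j, (j < n)%N ->
    fde_solution gamma T m alpha_ a (Y j) /\
    forall k, (k < n)%N -> init_value T k (Y j) (if k == j then 1 else 0).

Definition H_set (m : nat) (alpha_ : nat -> R) (x : R) : set nat :=
  [set i | (1 <= i <= m)%N /\ 0 <= alpha_ i <= x].

(* Phi_{j+1} where Phi_b(t) = t^(b-1) / Gamma(b). *)
Definition Phi_succ (j : nat) t : R := t ^+ j / j`!%:R.

End FractionalCalculus.

(* Main.v *)
Require Import Defs.
From mathcomp Require Import all_boot all_order all_algebra.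
From mathcomp Require Import all_classical all_reals all_analysis.
From mathcomp Require Import measurable_realfun ring lra.

(* Every alpha_i lies in (n0 - 1, n0], so all the Caputo derivatives act on the
   same remainder w, a solution minus its Taylor polynomial of degree n0 - 1.
   Put u = w^(n0), so that |u(t)| <= C t^(-gamma) and the Caputo derivative of
   order alpha_i is I^(n0 - alpha_i) u.  The equation becomes
   I^gamma u = - sum_i a_i I^(n0 - alpha_i) u, and the semigroup law turns it
   into a linear Volterra equation v = - sum_i a_i I^(alpha_0 - alpha_i) v for
   the bounded function v = I^gamma u.  Its kernel is weakly singular and the
   a_i are bounded, so comparing v with exp(lambda t) for a large lambda gives
   v = 0.  Hence I^1 u = I^(1 - gamma) v = 0, i.e. w^(n0 - 1) = 0, and w = 0.
   So the solutions are exactly the polynomials of degree < n0. *)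

(** Emptiness of H does more than unify notation. A term with alpha_i at most n0 - 1 would subtract
    a shorter Taylor polynomial and in general leave a contribution of t^(n0-1), so polynomials of
    degree below n0 would no longer be annihilated term by term. The technical obstacle is that u
    may blow up like t^(-gamma) at 0, while the kernels are singular at the other end. Everything is
    therefore done in the class of functions on the whole line that vanish for x <= 0 and are
    bounded by C x^(e-1) with e > 0. Integration of order b maps exponent e to b + e, and e > 0
    supplies the integrability needed for Fubini. Singular kernels are never differentiated: I^b
    commutes with I^1, which leaves an integral of order 1 with a continuous integrand. The passage
    from u to v trades an equation of the first kind for one of the second kind, and v is bounded
    because gamma + (1 - gamma) = 1. Kernels carry no factor 1/Gamma, so the semigroup law produces
    beta values, whose positivity allows them to be cancelled. *)

Set Implicit Arguments.
Unset Strict Implicit.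
Unset Printing Implicit Defensive.

Import Order.TTheory GRing.Theory Num.Theory.
Import numFieldNormedType.Exports.

Local Open Scope classical_set_scope.
Local Open Scope ring_scope.

(** * Affine changes of variable *)

Section AffineChangeOfVariable.
Context {R : realType}.
Notation mu := (@lebesgue_measure R).
Local Open Scope ereal_scope.

Lemma measurable_affine (c d : R) :
  measurable_fun [set: measurableTypeR R]
    ((fun x => c * x + d)%R : measurableTypeR R -> measurableTypeR R).
Proof. by apply: measurable_funD => //; apply: measurable_funM. Qed.

(** Lebesgue measure is [c] times its image under the affine map, since the two agree on half-open
    intervals, which determine it. The rest is integration against an image measure. *)
Lemma ge0_integral_affine (c d : R) (f : R -> \bar R) :
  (0 < c)%R -> measurable_fun [set: R] f -> (forall x, 0 <= f x) ->
  \int[mu]_x f x = c%:E * \int[mu]_x f (c * x + d)%R.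
Proof.
move=> c0 mf f0; pose phi x : measurableTypeR R := (c * x + d)%R.
have mphi : measurable_fun [set: measurableTypeR R] phi by exact: measurable_affine.
(* The pushforward is repackaged with its measure structure, so that the uniqueness of Lebesgue
   measure applies to it. *)
have [nu nuE] : exists nu : {measure set (measurableTypeR R) -> \bar R},
    nu = pushforward mu phi :> (set _ -> _).
  by unshelve eexists (pushforward mu phi).
pose k : {nonneg R} := NngNum (ltW c0).
have -> : \int[mu]_x f x = \int[mscale k nu]_x f x.
  apply: eq_measure_integral => A mA _ /=.
  apply: lebesgue_measure_unique => //= _ [[a b]] _ <-.
  rewrite /mscale nuE /pushforward /=.
  have -> : phi @^-1` `]a, b] = `]((a - d) / c)%R, ((b - d) / c)%R]%classic.
    apply/seteqP; split => x /=; rewrite !in_itv /=;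
      by rewrite ltr_pdivrMr // ler_pdivlMr // ltrBlDr lerBrDr mulrC.
  rewrite !lebesgue_measure_itv /= !lte_fin.
  rewrite ltr_pM2r ?invr_gt0 // ltrD2r; case: ifPn => ab; last by rewrite mule0.
  rewrite -!EFinB -EFinM; congr EFin; field; exact: lt0r_neq0.
rewrite (ge0_integral_mscale nu measurableT k mf) //=.
by rewrite nuE ge0_integral_pushforward.
Qed.

Lemma ge0_integral_reflect (f : R -> \bar R) :
  measurable_fun [set: R] f -> (forall x, 0 <= f x) ->
  \int[mu]_x f x = \int[mu]_x f (- x)%R.
Proof.
move=> mf f0.
have mN : measurable_fun [set: measurableTypeR R]
    (-%R : measurableTypeR R -> measurableTypeR R) by exact: oppr_measurable.
have [nu nuE] : exists nu : {measure set (measurableTypeR R) -> \bar R},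
    nu = pushforward mu (-%R : _ -> measurableTypeR R) :> (set _ -> _).
  by unshelve eexists (pushforward mu (-%R : _ -> measurableTypeR R)).
transitivity (\int[nu]_x f x); last by rewrite nuE ge0_integral_pushforward.
by apply: eq_measure_integral => A mA _; rewrite /= nuE lebesgue_measureN.
Qed.

Lemma Rintegral_affine (c d : R) (f : R -> R) : (0 < c)%R ->
  mu.-integrable [set: R] (EFin \o f) ->
  mu.-integrable [set: R] (EFin \o (fun x => f (c * x + d))%R) /\
  (\int[mu]_x f x = c * \int[mu]_x f (c * x + d))%R.
Proof.
move=> c0 fi; have mf := measurable_int _ fi.
have fi' : mu.-integrable [set: R] (EFin \o (fun x => f (c * x + d))%R).
  apply/integrableP; split.
    apply: (measurableT_comp (f := EFin \o f) mf); exact: measurable_affine.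
  case/integrableP: fi => _; rewrite (ge0_integral_affine d c0) //; last first.
    by apply: measurableT_comp.
  by rewrite -[X in _ < X](@gt0_muley R c%:E) ?lte_fin // lte_pmul2l.
split => //.
pose h x := f (c * x + d)%R.
have E : \int[mu]_x (EFin \o f) x = c%:E * \int[mu]_x (EFin \o h) x.
  rewrite [LHS]integralE [in RHS]integralE muleBr //; last first.
    apply: fin_num_adde_defr.
    exact: (integrable_fin_num measurableT (integrable_funepos measurableT fi')).
  congr (_ - _).
    have e := ge0_integral_affine d c0 (measurable_funepos mf) (funepos_ge0 _).
    rewrite e; congr (_ * _); by apply: eq_integral => x _; rewrite 2!funeposE.
  have e := ge0_integral_affine d c0 (measurable_funeneg mf) (funeneg_ge0 _).
  rewrite e; congr (_ * _); by apply: eq_integral => x _; rewrite 2!funenegE.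
rewrite /Rintegral E fineM //; exact: integrable_fin_num.
Qed.
End AffineChangeOfVariable.

(** * The power kernel and Euler's beta integral *)

Section PowerKernel.
Context {R : realType}.
Notation mu := (@lebesgue_measure R).
Implicit Types b d r s t x : R.

(* Extended by 0 to x <= 0, so that fractional integrals become convolutions
   on the whole line. *)
Definition pker b x : R := if 0 < x then x `^ (b - 1) else 0.

Lemma pker_ge0 b x : 0 <= pker b x.
Proof. by rewrite /pker; case: ifPn => // _; exact: powR_ge0. Qed.

Lemma pkerE b x : 0 < x -> pker b x = x `^ (b - 1).
Proof. by rewrite /pker => ->. Qed.

Lemma pker_le0 b x : x <= 0 -> pker b x = 0.
Proof. by rewrite /pker ltNge => ->. Qed.

Lemma pkerM b c x : 0 < c -> pker b (c * x) = c `^ (b - 1) * pker b x.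
Proof.
move=> c0; rewrite /pker pmulr_rgt0 //; case: ifPn => [x0|]; last by rewrite mulr0.
by rewrite powRM // ltW.
Qed.

Lemma measurable_pker b : measurable_fun [set: R] (pker b).
Proof.
apply: measurable_fun_if => //.
- exact: measurable_fun_ltr.
- by apply: measurable_funTS; exact: measurable_powR.
Qed.

Lemma is_derive_powR p x : 0 < x -> is_derive x 1 (@powR R ^~ p) (p * x `^ (p - 1)).
Proof.
move=> x0; have xp : x \in `]0, +oo[ by rewrite in_itv /= x0.
have := powR_derive1 p xp; rewrite derive1E => <-.
apply: DeriveDef => //; exact: derivable_powR.
Qed.

Lemma continuous_powR_pos p x : 0 < x -> {for x, continuous (@powR R ^~ p)}.
Proof.
move=> x0; apply: differentiable_continuous; apply/derivable1_diffP.
by have := is_derive_powR p x0; case.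
Qed.

(** For [b < 1] the integrand is unbounded at 0, so the fundamental theorem is used on [1/(i+1), 1]
    and the bound passes to the limit by monotone convergence. *)
Lemma integral_powR_01_le b : 0 < b ->
  (\int[mu]_(x in `]0%R, 1%R]) (x `^ (b - 1))%:E <= (b^-1)%:E)%E.
Proof.
move=> b0.
pose F (i : nat) : set R := `[i.+1%:R^-1, 1]%classic.
have UF : `]0, 1]%classic = \bigcup_i F i.
  apply/seteqP; split => [x /=|x [i _]]; rewrite /F /= !in_itv /=.
    move=> /andP[x0 x1].
    have [n _ /(_ n (leqnn n)) /= nx] := near_infty_natSinv_lt (PosNum x0).
    by exists n => //=; rewrite in_itv /= x1 ltW.
  by move=> /andP[ix ->]; rewrite andbT (lt_le_trans _ ix) // invr_gt0.
rewrite UF.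
have mp i : measurable_fun (F i) (fun x : R => (x `^ (b - 1))%:E).
  by apply/measurable_EFinP; apply: measurable_funTS; exact: measurable_powR.
have ndF : nondecreasing_seq F.
  move=> i j ij; apply/subsetPset => x; rewrite /F /= !in_itv /= => /andP[h ->].
  by rewrite andbT (le_trans _ h) // lef_pV2 ?posrE // ler_nat.
have mF i : measurable (F i) by exact: measurable_itv.
have cv := @ge0_nondecreasing_set_cvg_integral _ (measurableTypeR R) R F _ mu
  ndF mF mp.
have {}cv := cv (fun _ x _ => powR_ge0 x (b - 1)).
rewrite -(cvg_lim _ cv) //; apply: lime_le; first by apply/cvg_ex; eexists; exact: cv.
(* For index 0 the interval is the single point 1, whereas the fundamental theorem wants distinct
   end points. *)
apply: nearW => -[|n].
  by rewrite /F invr1 set_itv1 integral_set1 lee_fin invr_ge0 ltW.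
rewrite /F; set e := (n.+2%:R^-1 : R).
have e0 : 0 < e by rewrite invr_gt0.
have e1 : e < 1 by rewrite invf_lt1 // ltr1n.
have cf p x : e <= x -> {for x, continuous (@powR R ^~ p)}.
  by move=> ex; apply: continuous_powR_pos; exact: lt_le_trans ex.
have dF x : 0 < x -> is_derive x 1 (fun x => b^-1 * x `^ b) (x `^ (b - 1)).
  move=> x0; have := is_derive_powR b x0 => h.
  have := @is_deriveZ _ _ _ (@powR R ^~ b) b^-1 x 1 _ h.
  by rewrite /GRing.scale /= mulrA mulVf ?gt_eqF // mul1r.
rewrite (@continuous_FTC2 _ _ (fun x => b^-1 * x `^ b)) //.
- rewrite powR1 mulr1 -EFinB lee_fin gerBl mulr_ge0 ?powR_ge0 //.
  by rewrite invr_ge0 ltW.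
- apply/continuous_within_itvP => //; split.
  + by move=> x; rewrite in_itv /= => /andP[/ltW ex _]; exact: cf.
  + by apply: cvg_at_right_filter; exact: cf.
  + by apply: cvg_at_left_filter; apply: cf; exact: ltW.
- split.
  + move=> x; rewrite in_itv /= => /andP[/ltW ex _].
    by case: (dF x (lt_le_trans e0 ex)).
  + by apply: cvg_at_right_filter; apply: cvgMr; exact: cf.
  + by apply: cvg_at_left_filter; apply: cvgMr; apply: cf; exact: ltW.
- move=> x; rewrite in_itv /= => /andP[/ltW ex _].
  by case: (dF x (lt_le_trans e0 ex)) => _ <-; rewrite derive1E.
Qed.

Definition pker01 b x := pker b x * \1_(`]0, 1]%classic : set R) x.

(** The power increases or decreases according to the sign of [b - 1]; adding its values at 1 and at
    1/2 covers both cases. *)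
Lemma pker_bound b x : 2^-1 <= x -> x <= 1 -> pker b x <= 1 + 2^-1 `^ (b - 1).
Proof.
move=> hx x1; have x0 : 0 < x by lra.
rewrite pkerE //; have [b1|b1] := leP 0 (b - 1).
  rewrite (@le_trans _ _ 1) ?lerDl ?powR_ge0 //.
  have := ge0_ler_powR b1 _ _ x1; rewrite powR1; apply; by rewrite nnegrE ?ltW.
rewrite (@le_trans _ _ (2^-1 `^ (b - 1))) ?lerDr //.
rewrite -[b - 1]opprK [leLHS]powRN [leRHS]powRN lef_pV2 ?posrE ?powR_gt0 //.
by rewrite ge0_ler_powR // ?nnegrE; lra.
Qed.

Lemma integral_pker01_lty b : 0 < b ->
  (\int[mu]_x (pker01 b x)%:E < +oo)%E.
Proof.
move=> b0; apply: le_lt_trans (ltry b^-1); apply: le_trans (integral_powR_01_le b0).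
rewrite [leRHS]integral_mkcond le_eqVlt; apply/predU1l/eq_integral => x _.
rewrite /pker01 /patch indicE; case: ifPn => h; last by rewrite mulr0.
by rewrite mulr1 pkerE //; move: h; rewrite inE /= in_itv /= => /andP[].
Qed.

Lemma measurable_pker01 b : measurable_fun [set: R] (pker01 b).
Proof.
apply: measurable_funM; first exact: measurable_pker.
exact: measurable_indic.
Qed.

Definition beta b d : R := \int[mu]_s (pker b (1 - s) * pker d s).

(** Cutting at 1/2 leaves one singular factor on each half; [pker_bound] controls the other one. *)
Lemma beta_integrand_le b d s :
  pker b (1 - s) * pker d s <=
  (1 + 2^-1 `^ (b - 1)) * pker01 d s + (1 + 2^-1 `^ (d - 1)) * pker01 b (1 - s).
Proof.
have C0 p : 0 <= 1 + 2^-1 `^ (p - 1) :> R by rewrite addr_ge0 // powR_ge0.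
have P0 p x : 0 <= pker01 p x by rewrite mulr_ge0 // ?pker_ge0 // indicE.
have [s0|s0] := leP s 0.
  by rewrite (pker_le0 d) // mulr0 addr_ge0 // mulr_ge0.
have [s1|s1] := leP 1 s.
  by rewrite (pker_le0 b) ?subr_le0 // mul0r addr_ge0 // mulr_ge0.
have [s2|s2] := leP s 2^-1.
  apply: ler_wpDr; first by rewrite mulr_ge0.
  rewrite /pker01 indicE mem_set /= ?in_itv /= ?s0 ?(ltW s1) // mulr1.
  by rewrite ler_wpM2r ?pker_ge0 // pker_bound //; lra.
apply: ler_wpDl; first by rewrite mulr_ge0.
rewrite /pker01 indicE mem_set /= ?in_itv /=; last by apply/andP; split; lra.
by rewrite mulr1 mulrC ler_wpM2r ?pker_ge0 // pker_bound //; lra.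
Qed.
End PowerKernel.

(** * Finiteness, symmetry and positivity of the beta integral; convolution of two kernels *)

Section Beta.
Context {R : realType}.
Notation mu := (@lebesgue_measure R).
Implicit Types b d r s t x : R.

Lemma ge0_integral_sub (c : R) (f : R -> \bar R) :
  measurable_fun [set: R] f -> (forall x, 0 <= f x)%E ->
  (\int[mu]_x f x = \int[mu]_x f (c - x)%R)%E.
Proof.
move=> mf f0; rewrite ge0_integral_reflect //.
rewrite (@ge0_integral_affine _ 1 (- c)) //.
  by rewrite mul1e; apply: eq_integral => x _; rewrite mul1r opprB.
by apply: measurableT_comp => //; exact: oppr_measurable.
Qed.

Lemma measurable_pker_sub b t : measurable_fun [set: R] (fun s => pker b (t - s)).
Proof.
by apply: (measurableT_comp (measurable_pker b)); apply: measurable_funB.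
Qed.

Lemma measurable_pker_subr b t : measurable_fun [set: R] (fun s => pker b (s - t)).
Proof.
by apply: (measurableT_comp (measurable_pker b)); apply: measurable_funB.
Qed.

Lemma beta_lty b d : 0 < b -> 0 < d ->
  (\int[mu]_s (pker b (1 - s) * pker d s)%:E < +oo)%E.
Proof.
move=> b0 d0.
have C0 p : 0 <= 1 + 2^-1 `^ (p - 1) :> R by rewrite addr_ge0 // powR_ge0.
have P0 p x : 0 <= pker01 p x :> R.
  by rewrite mulr_ge0 // ?pker_ge0 // indicE.
have m1 : measurable_fun [set: R] (fun s => pker01 b (1 - s)).
  by apply: (measurableT_comp (measurable_pker01 b)); apply: measurable_funB.
apply: (@le_lt_trans _ _ (\int[mu]_s
    ((1 + 2^-1 `^ (b - 1)) * pker01 d s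
     + (1 + 2^-1 `^ (d - 1)) * pker01 b (1 - s))%:E)%E).
  apply: ge0_le_integral => //.
  - by move=> x _; rewrite lee_fin mulr_ge0 // pker_ge0.
  - apply/measurable_EFinP; apply: measurable_funM; last exact: measurable_pker.
    exact: measurable_pker_sub.
  - apply/measurable_EFinP/measurable_funD; apply/measurable_funM => //.
    exact: measurable_pker01.
  - by move=> x _; rewrite lee_fin beta_integrand_le.
under eq_integral => s _ do
  rewrite EFinD (EFinM _ (pker01 d s)) (EFinM _ (pker01 b (1 - s))).
rewrite ge0_integralD //; last first.
- by apply: measurable_funeM; exact/measurable_EFinP.
- by move=> x _; rewrite mule_ge0 // lee_fin.
- by apply: measurable_funeM; apply/measurable_EFinP; exact: measurable_pker01.
- by move=> x _; rewrite mule_ge0 // lee_fin.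
rewrite !ge0_integralZl_EFin //; last first.
- by apply/measurable_EFinP; exact: measurable_pker01.
- by move=> x _; rewrite lee_fin.
- exact/measurable_EFinP.
- by move=> x _; rewrite lee_fin.
apply: lte_add_pinfty; rewrite lte_mul_pinfty ?lee_fin ?integral_pker01_lty //.
rewrite -(@ge0_integral_sub 1 (fun x => (pker01 b x)%:E)) ?integral_pker01_lty //.
  by apply/measurable_EFinP; exact: measurable_pker01.
by move=> x; rewrite lee_fin.
Qed.

Lemma betaE b d : 0 < b -> 0 < d ->
  (\int[mu]_s (pker b (1 - s) * pker d s)%:E = (beta b d)%:E)%E.
Proof.
move=> b0 d0; rewrite /beta /Rintegral fineK // ge0_fin_numE ?beta_lty //.
by apply: integral_ge0 => x _; rewrite lee_fin mulr_ge0 // pker_ge0.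
Qed.

Lemma beta_ge0 b d : 0 <= beta b d.
Proof. by apply: Rintegral_ge0 => x _; rewrite mulr_ge0 // pker_ge0. Qed.

Lemma betaC b d : beta b d = beta d b.
Proof.
have E : (\int[mu]_s (pker b (1 - s) * pker d s)%:E =
    \int[mu]_s (pker d (1 - s) * pker b s)%:E)%E.
  rewrite (ge0_integral_sub 1).
  - apply: eq_integral => x _; rewrite mulrC.
    by rewrite (_ : 1 - (1 - x) = x) //; ring.
  - apply/measurable_EFinP; apply: measurable_funM; last exact: measurable_pker.
    exact: measurable_pker_sub.
  - by move=> x; rewrite lee_fin mulr_ge0 // pker_ge0.
by rewrite /beta /Rintegral E.
Qed.

(** With both exponents nonpositive the integrand is at least 1 on (0, 1), so the integral is at
    least 1. *)
Lemma beta_gt0 b d : 0 < b <= 1 -> 0 < d <= 1 -> 0 < beta b d.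
Proof.
move=> /andP[b0 b1] /andP[d0 d1].
have k1 p x : p <= 1 -> 0 < x < 1 -> 1 <= pker p x :> R.
  move=> p1 /andP[x0 x1]; rewrite pkerE // -[p - 1]opprK powRN.
  rewrite -[leLHS]invr1 lef_pV2 ?posrE ?powR_gt0 //.
  have p0 : 0 <= - (p - 1) by lra.
  have := ge0_ler_powR p0 _ _ (ltW x1); rewrite powR1; apply; rewrite nnegrE //.
  exact: ltW.
suff : (1%:E <= (beta b d)%:E)%E by rewrite lee_fin; exact: lt_le_trans.
rewrite -betaE //.
have -> : (1%:E = \int[mu]_x (\1_(`]0%R, 1%R[%classic : set R) x)%:E)%E.
  rewrite integral_indic //= setIT lebesgue_measure_itv /= lte_fin ltr01.
  by rewrite -EFinB subr0.
apply: ge0_le_integral => //.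
- by apply/measurable_EFinP; exact: measurable_indic.
- apply/measurable_EFinP; apply: measurable_funM; last exact: measurable_pker.
  exact: measurable_pker_sub.
move=> x _; rewrite lee_fin indicE; case: (boolP (x \in _)) => [|_]; last first.
  by rewrite mulr_ge0 // pker_ge0.
rewrite inE /= in_itv /= => /andP[x0 x1].
rewrite -[leLHS]mul1r ler_pM // ?k1 //; apply/andP; split; lra.
Qed.

(** The substitution s = (t - r) x + r reduces the case r < t to the beta integral, homogeneity of
    the kernels giving the power of t - r. For t <= r the supports are disjoint. *)
Lemma pker_conv b d t r : 0 < b -> 0 < d ->
  (\int[mu]_s (pker b (t - s) * pker d (s - r))%:E =
   (beta b d * pker (b + d) (t - r))%:E)%E.
Proof.
move=> b0 d0; have [tr|rt] := leP t r.
  rewrite (@pker_le0 _ _ (t - r)) ?subr_le0 // mulr0 integral0_eq // => s _.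
  have [ts|st] := leP t s.
    by rewrite (@pker_le0 _ _ (t - s)) ?subr_le0 // mul0r.
  by rewrite (@pker_le0 _ _ (s - r)) ?mulr0 // subr_le0; lra.
have c0 : 0 < t - r by rewrite subr_gt0.
have m2 : measurable_fun [set: R] (fun s => pker b (t - s) * pker d (s - r)).
  apply: measurable_funM; first exact: measurable_pker_sub.
  exact: measurable_pker_subr.
have p0 s u : (0 <= (pker b s * pker d u)%:E)%E.
  by rewrite lee_fin mulr_ge0 // pker_ge0.
rewrite (@ge0_integral_affine _ (t - r) r) //; last exact/measurable_EFinP.
under eq_integral => x _.
  rewrite (_ : t - ((t - r) * x + r) = (t - r) * (1 - x)); last by ring.
  rewrite addrK !pkerM // mulrACA EFinM; over.
rewrite ge0_integralZl_EFin ?betaE // ?mulr_ge0 ?powR_ge0 //; last first.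
  apply/measurable_EFinP; apply: measurable_funM; last exact: measurable_pker.
  exact: measurable_pker_sub.
rewrite -!EFinM; congr EFin; rewrite pkerE // [RHS]mulrC mulrA; congr (_ * _).
rewrite -powRD; last by rewrite (gt_eqF c0) implybT.
rewrite -[X in X * _]powRr1 ?ltW // -powRD; last by rewrite (gt_eqF c0) implybT.
by congr (_ `^ _); ring.
Qed.
End Beta.

(** * Fractional integrals as convolutions *)

Section Convolution.
Context {R : realType}.
Notation mu := (@lebesgue_measure R).
Implicit Types b d e C r s t x : R.
Implicit Types f g : R -> R.

(* Gamma(b) times the Riemann-Liouville integral of order b of f, for f
   vanishing on the negative half-line. *)
Definition pconv b f t : R := \int[mu]_s (pker b (t - s) * f s).

(* With e = 1 - gamma this is |f x| <= C x^(-gamma) for x > 0, and f = 0 on the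
   rest of the line. *)
Definition pker_dominated C e f :=
  measurable_fun [set: R] f /\ forall x, `|f x| <= C * pker e x.

Lemma pker_dominated_ge0 C e f : pker_dominated C e f -> 0 <= C.
Proof.
case=> _ /(_ 1); rewrite pkerE // powR1 mulr1; exact: le_trans.
Qed.

Lemma pker_dominated_le0 C e f x : pker_dominated C e f -> x <= 0 -> f x = 0.
Proof.
by case=> _ /(_ x) + x0; rewrite pker_le0 // mulr0 normr_le0 => /eqP.
Qed.

Lemma pker_pker_integral b e t : 0 < b -> 0 < e ->
  (\int[mu]_s (pker b (t - s) * pker e s)%:E = (beta b e * pker (b + e) t)%:E)%E.
Proof.
move=> b0 e0; have := pker_conv t 0 b0 e0; rewrite subr0 => <-.
by apply: eq_integral => s _; rewrite subr0.
Qed.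

Lemma measurable_pker_mul b t f : measurable_fun [set: R] f ->
  measurable_fun [set: R] (fun s => pker b (t - s) * f s).
Proof. by move=> mf; apply: measurable_funM => //; exact: measurable_pker_sub. Qed.

Lemma integrable_pker_pker b e t : 0 < b -> 0 < e ->
  mu.-integrable [set: R] (fun s => (pker b (t - s) * pker e s)%:E).
Proof.
move=> b0 e0; apply/integrableP; split.
  by apply/measurable_EFinP; apply: measurable_pker_mul; exact: measurable_pker.
under eq_integral do rewrite gee0_abs ?lee_fin ?mulr_ge0 ?pker_ge0 //.
by rewrite pker_pker_integral // ltry.
Qed.

Lemma integrable_pconv C e b f t : 0 < b -> 0 < e -> pker_dominated C e f ->
  mu.-integrable [set: R] (fun s => (pker b (t - s) * f s)%:E).
Proof.
move=> b0 e0 fC; have [mf fle] := fC.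
have iC : mu.-integrable [set: R]
    (fun s => (C%:E * (pker b (t - s) * pker e s)%:E))%E.
  by apply: integrableZl => //; exact: integrable_pker_pker.
apply: (le_integrable measurableT _ _ iC).
  by apply/measurable_EFinP; exact: measurable_pker_mul.
move=> s _ /=; have CP : 0 <= C * (pker b (t - s) * pker e s).
  by rewrite mulr_ge0 ?(pker_dominated_ge0 fC) // mulr_ge0 // pker_ge0.
rewrite lee_fin (ger0_norm CP) normrM ger0_norm ?pker_ge0 //.
by rewrite mulrCA ler_wpM2l // pker_ge0.
Qed.

(** The gain in the exponent matters: for [b = 1 - e] the majorant [pker 1] is constant on x > 0,
    which is how v becomes bounded. *)
Lemma pconv_bound C e b f t : 0 < b -> 0 < e -> pker_dominated C e f ->
  `|pconv b f t| <= C * beta b e * pker (b + e) t.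
Proof.
move=> b0 e0 fC; have [mf fle] := fC; rewrite /pconv.
have iP := integrable_pker_pker t b0 e0.
apply: le_trans (le_normr_Rintegral _ (integrable_pconv t b0 e0 fC)) _ => //.
rewrite -mulrA -[beta b e * _]/(fine (beta b e * pker (b + e) t)%:E).
rewrite -pker_pker_integral // -[fine _]/(Rintegral _ _ _) -RintegralZl //.
apply: le_Rintegral => //.
- apply: (integrable_norm (integrable_pconv t b0 e0 fC)) => //.
- exact: (integrableZl measurableT C iP).
move=> s _; rewrite normrM ger0_norm ?pker_ge0 // mulrCA ler_wpM2l ?pker_ge0 //.
Qed.

Lemma measurable_pker_diff b :
  measurable_fun [set: measurableTypeR R * measurableTypeR R]
    (fun z : measurableTypeR R * measurableTypeR R => pker b (z.1 - z.2)).
Proof.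
apply: (measurableT_comp (measurable_pker b)).
by apply: measurable_funB; [exact: measurable_fst|exact: measurable_snd].
Qed.

(** Tonelli gives measurability in the parameter, separately for the positive and the negative part
    of the integrand. *)
Lemma measurable_pconv b f : measurable_fun [set: R] f ->
  measurable_fun [set: R] (pconv b f).
Proof.
move=> mf.
pose F (z : measurableTypeR R * measurableTypeR R) := (pker b (z.1 - z.2) * f z.2)%:E.
have mF : measurable_fun setT F.
  apply/measurable_EFinP; apply: measurable_funM; first exact: measurable_pker_diff.
  by apply: (measurableT_comp mf); exact: measurable_snd.
apply: (measurableT_comp (fine_measurable measurableT)).
have -> : (fun t => \int[mu]_s (pker b (t - s) * f s)%:E)%E =
    (fubini_F mu F^\+ \- fubini_F mu F^\-)%E.
  apply/funext => t; rewrite [LHS]integralE /fubini_F.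
  by congr (_ - _)%E; apply: eq_integral => s _; rewrite ?funeposE ?funenegE.
apply: emeasurable_funB; apply: measurable_fun_fubini_tonelli_F => //.
- exact: measurable_funepos.
- exact: measurable_funeneg.
Qed.

Lemma pker_dominated_pconv C e b f : 0 < b -> 0 < e -> pker_dominated C e f ->
  pker_dominated (C * beta b e) (b + e) (pconv b f).
Proof.
move=> b0 e0 fC; split; first by apply: measurable_pconv; case: fC.
by move=> x; exact: pconv_bound fC.
Qed.

(** This is the semigroup law for unnormalised kernels, by Fubini. Absolute integrability is checked
    with s innermost: there [pker_conv] evaluates the integral exactly and what remains is covered
    by [integrable_pconv]. *)
Lemma pconv_pconv C e b d f t : 0 < b -> 0 < d -> 0 < e -> pker_dominated C e f ->
  pconv b (pconv d f) t = beta b d * pconv (b + d) f t.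
Proof.
move=> b0 d0 e0 fC; have [mf fle] := fC; have C0 := pker_dominated_ge0 fC.
have bd0 : 0 < b + d by rewrite addr_gt0.
pose T := measurableTypeR R.
pose G (z : T * T) := pker b (t - z.1) * pker d (z.1 - z.2).
pose F (z : T * T) := (G z * f z.2)%:E.
have mG : measurable_fun [set: T * T] G.
  apply: measurable_funM; last exact: measurable_pker_diff.
  by apply: (measurableT_comp (measurable_pker_sub b t)); exact: measurable_fst.
have mF : measurable_fun [set: T * T] F.
  apply/measurable_EFinP; apply: measurable_funM => //.
  by apply: (measurableT_comp mf); exact: measurable_snd.
have G0 z : 0 <= G z by rewrite mulr_ge0 // pker_ge0.
have mG1 r : measurable_fun [set: R] (fun s => G (s, r)).
  by apply: measurable_funM; [exact: measurable_pker_sub|exact: measurable_pker_subr].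
have Gr r : (\int[mu]_s (G (s, r))%:E = (beta b d * pker (b + d) (t - r))%:E)%E.
  exact: pker_conv.
have iGr r : mu.-integrable [set: R] (fun s => (G (s, r))%:E).
  apply/integrableP; split; first by apply/measurable_EFinP; exact: mG1.
  by under eq_integral do rewrite gee0_abs ?lee_fin //; rewrite Gr ltry.
have iF : (mu \x mu)%E.-integrable setT F.
  apply/(integrable21ltyP mu mu mF).
  have ie : mu.-integrable [set: R]
      (fun r => (beta b d * (pker (b + d) (t - r) * f r))%:E).
    exact: (integrableZl measurableT (beta b d) (integrable_pconv t bd0 e0 fC)).
  case/integrableP : ie => _; congr (_ < _)%E; apply: eq_integral => r _ /=.
  under [RHS]eq_integral => s _ do
    rewrite /F /= normrM (ger0_norm (G0 _)) mulrC EFinM.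
  rewrite ge0_integralZl_EFin //; first last.
  - by apply/measurable_EFinP; exact: mG1.
  - by move=> s _; rewrite lee_fin.
  rewrite Gr -EFinM !normrM ger0_norm ?beta_ge0 // ger0_norm ?pker_ge0 //.
  by congr EFin; ring.
have FF := Fubini iF.
rewrite /pconv /Rintegral.
transitivity (fine (\int[mu]_s \int[mu]_r F (s, r))%E).
  congr fine; apply: eq_integral => s _; rewrite /F /G /=.
  transitivity
    (\int[mu]_r ((pker b (t - s))%:E * (pker d (s - r) * f r)%:E))%E; last first.
    by apply: eq_integral => r _; rewrite -EFinM mulrA.
  rewrite integralZl //; last exact: (integrable_pconv s d0 e0 fC).
  rewrite EFinM /pconv /Rintegral fineK //.
  exact: integrable_fin_num (integrable_pconv s d0 e0 fC).
rewrite FF.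
transitivity (fine (\int[mu]_r ((beta b d)%:E * (pker (b + d) (t - r) * f r)%:E))%E).
  congr fine; apply: eq_integral => r _; rewrite /F.
  transitivity (\int[mu]_s ((f r)%:E * (G (s, r))%:E))%E.
    by apply: eq_integral => s _; rewrite -EFinM mulrC.
  rewrite integralZl //= Gr -!EFinM; congr EFin; ring.
rewrite integralZl //; last exact: (integrable_pconv t bd0 e0 fC).
rewrite fineM //; exact: integrable_fin_num (integrable_pconv t bd0 e0 fC).
Qed.
End Convolution.

(** * Locality, scaling and continuity of fractional integrals *)

Section Derivative.
Context {R : realType}.
Notation mu := (@lebesgue_measure R).
Implicit Types b d e C T r s t x : R.
Implicit Types f g : R -> R.

Lemma eq_pconv b f g t : (forall s, s < t -> f s = g s) ->
  pconv b f t = pconv b g t.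
Proof.
move=> fg; rewrite /pconv; apply: eq_Rintegral => s _.
have [ts|st] := leP t s; last by rewrite fg.
by rewrite pker_le0 ?mul0r // subr_le0.
Qed.

(** The cut-off at [T] does not depend on [t], so one function on the line serves all [t] and the
    integral can be differentiated in [t]. *)
Lemma pconv_Rintegral b f T t : t <= T ->
  \int[mu]_(s in `]0, t[) ((t - s) `^ (b - 1) * f s) =
  pconv b (f \_ `]0, T[) t.
Proof.
move=> tT; rewrite Rintegral_mkcond; apply: eq_Rintegral => s _.
rewrite /patch; case: ifPn; rewrite ?inE ?notin_setE /= in_itv /=.
  move=> /andP[s0 st]; rewrite mem_set /= ?in_itv /= ?s0 ?(lt_le_trans st) //.
  by rewrite pkerE ?subr_gt0.
move=> /negP; rewrite negb_and -!leNgt => /orP[s0|ts].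
  rewrite ifF ?mulr0 //; apply/negbTE; rewrite notin_setE /= in_itv /=.
  by rewrite ltNge s0.
by rewrite pker_le0 ?mul0r // subr_le0.
Qed.

Lemma pker_dominated_scale C e f t : 0 < t -> pker_dominated C e f ->
  pker_dominated (C * t `^ (e - 1)) e (fun x => f (t * x)).
Proof.
move=> t0 [mf fle]; split.
  by apply: (measurableT_comp mf); exact: measurable_funM.
by move=> x; rewrite -mulrA -pkerM.
Qed.

(** The substitution s = t x moves [t] out of the singular kernel into the argument of [f], which
    prepares continuity in [t] by domination. *)
Lemma pconv_scale C e b f t : 0 < b -> 0 < e -> pker_dominated C e f -> 0 < t ->
  pconv b f t = t `^ b * pconv b (fun x => f (t * x)) 1.
Proof.
move=> b0 e0 fC t0.
have [_ E] := Rintegral_affine 0 t0 (integrable_pconv t b0 e0 fC).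
rewrite [LHS]E -(mulr_powRB1 (ltW t0) b0) -mulrA; congr (_ * _).
rewrite /pconv -RintegralZl //; last first.
  exact: (integrable_pconv 1 b0 e0 (pker_dominated_scale t0 fC)).
apply: eq_Rintegral => x _; rewrite addr0 (_ : t - t * x = t * (1 - x)); last by ring.
by rewrite pkerM // -mulrA.
Qed.

Lemma continuous_pconv C e b f T t : 0 < b -> 0 < e -> pker_dominated C e f ->
  (forall s, 0 < s < T -> {for s, continuous f}) -> 0 < t < T ->
  {for t, continuous (pconv b f)}.
Proof.
move=> b0 e0 fC cf /andP[t0 tT].
have C0 := pker_dominated_ge0 fC.
(* The parameter stays above t/2 because l^(e-1) may be unbounded as l tends to 0. *)
pose u := t / 2; have u0 : 0 < u by rewrite divr_gt0.
have ut : u < t by rewrite /u; lra.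
pose F l x := pker b (1 - x) * f (l * x).
pose I : set R := `]u, T[%classic.
have I0 l : I l -> 0 < l.
  by rewrite /I /= in_itv /= => /andP[ul _]; exact: lt_trans ul.
have It : I t by rewrite /I /= in_itv /= ut.
have iF l : I l -> mu.-integrable [set: R] (EFin \o F l).
  by move=> /I0 l0; exact: (integrable_pconv 1 b0 e0 (pker_dominated_scale l0 fC)).
(* The sum of the two end values dominates l^(e-1) on (u, T) whatever the sign of [e - 1]. *)
pose M := C * (u `^ (e - 1) + T `^ (e - 1)).
have iG : mu.-integrable [set: R]
    (EFin \o (fun x => M * (pker b (1 - x) * pker e x))).
  exact: (integrableZl measurableT M (integrable_pker_pker 1 b0 e0)).
(* Outside 0 < x < 1 the integrand vanishes for all l > 0; inside, l x lies in (0, T), where [f] is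
   continuous. *)
have cF : {ae mu, forall x, [set: R] x -> {in I, continuous (F ^~ x)}}.
  apply: aeW => x _ l; rewrite inE => Il.
  have l0 := I0 _ Il; move: Il; rewrite /I /= in_itv /= => /andP[ul lT].
  have [x0|x0] := leP x 0.
    have F0 y : 0 < y -> F y x = 0.
      by move=> y0; rewrite /F (pker_dominated_le0 fC) ?mulr0 // mulr_ge0_le0 // ltW.
    rewrite /continuous_at F0 //; apply: (@cvg_trans _ (cst (0 : R) y @[y --> l])).
      by apply: near_eq_cvg; near=> y; rewrite /= F0 //; near: y; exact: lt_nbhsr.
    exact: (@cst_continuous R R 0 l).
  have [x1|x1] := leP 1 x.
    have F0 y : F y x = 0 by rewrite /F pker_le0 ?mul0r // subr_le0.
    rewrite /continuous_at F0 (_ : F ^~ x = cst 0); last exact/funext.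
    exact: (@cst_continuous R R 0 l).
  apply: (@continuousM R R (cst (pker b (1 - x))) (fun l => f (l * x))).
    exact: cst_continuous.
  apply: (@continuous_comp R R R (fun l => l * x) f); first exact: mulrr_continuous.
  apply: cf; rewrite mulr_gt0 //= (lt_le_trans _ (ltW lT)) // gtr_pMr //.
have Fle l : I l ->
    {ae mu, forall x, [set: R] x -> `|F l x| <= M * (pker b (1 - x) * pker e x)}.
  move=> Il; have l0 := I0 _ Il; move: Il; rewrite /I /= in_itv /= => /andP[ul lT].
  apply: aeW => x _; rewrite /F normrM ger0_norm ?pker_ge0 // mulrCA.
  rewrite ler_wpM2l ?pker_ge0 //; apply: le_trans (fC.2 _) _.
  rewrite pkerM // mulrA /M ler_wpM2r ?pker_ge0 // ler_wpM2l //.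
  have [e1|e1] := leP 0 (e - 1).
    by rewrite ler_wpDl ?powR_ge0 // ge0_ler_powR // ?nnegrE ltW // (lt_trans t0).
  rewrite ler_wpDr ?powR_ge0 // -[e - 1]opprK [leLHS]powRN [leRHS]powRN.
  rewrite lef_pV2 ?posrE ?powR_gt0 // ge0_ler_powR // ?nnegrE; lra.
have := continuity_under_integral measurableT iF cF iG Fle.
move=> /(_ t); rewrite inE => /(_ It) ct.
have cE : {near t, (fun l => l `^ b * pconv b (fun x => f (l * x)) 1) =1 pconv b f}.
  near=> l; rewrite /= (pconv_scale b0 e0 fC) //; near: l; exact: lt_nbhsr.
have tE : pconv b f t = t `^ b * pconv b (fun x => f (t * x)) 1.
  exact: (pconv_scale b0 e0 fC).
suff : pconv b f l @[l --> t] --> pconv b f t by [].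
rewrite tE; apply: cvg_trans; first exact: near_eq_cvg cE.
apply: (@continuousM R R (fun l => l `^ b) (fun l => pconv b (fun x => f (l * x)) 1)).
  exact: continuous_powR_pos.
exact: ct.
Unshelve. all: by end_near. Qed.

End Derivative.

(** * Differentiation of fractional integrals *)

Section FTC.
Context {R : realType}.
Notation mu := (@lebesgue_measure R).
Implicit Types b d e C T r s t x : R.
Implicit Types f g : R -> R.

Lemma pker_dominated_integrable C e f u : 0 < e -> pker_dominated C e f ->
  mu.-integrable `[0, u] (EFin \o f).
Proof.
move=> e0 fC.
(* The kernel of order 1 is constantly 1 before its end point; taking [u + 1] keeps the end [u] in
   that region. *)
have := integrable_pconv (u + 1) ltr01 e0 fC => h.
have {}h : mu.-integrable `[0, u] (fun s => (pker 1 (u + 1 - s) * f s)%:E).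
  exact: integrableS h.
apply: eq_integrable h => // s; rewrite inE /= in_itv /= => /andP[_ su].
rewrite pkerE; last by lra.
by rewrite subrr powRr0 mul1r.
Qed.

Lemma pconv1E C e f t : 0 < e -> pker_dominated C e f ->
  pconv 1 f t = \int[mu]_(s in `[0, t]) f s.
Proof.
move=> e0 fC; rewrite -Rintegral_itv_bndo_bndc; last first.
  apply: integrableS (pker_dominated_integrable t e0 fC) => //.
  by apply: subset_itv; rewrite bnd_simp.
rewrite Rintegral_mkcond; apply: eq_Rintegral => s _.
rewrite /patch; case: ifPn; rewrite ?inE ?notin_setE /= in_itv /=.
  by move=> /andP[_ st]; rewrite pkerE ?subr_gt0 // subrr powRr0 mul1r.
move=> /negP; rewrite negb_and -ltNge -leNgt => /orP[s0|ts].
  by rewrite (pker_dominated_le0 fC) ?mulr0 // ltW.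
by rewrite pker_le0 ?mul0r // subr_le0.
Qed.

Lemma is_derive_pconv1 C e f t : 0 < e -> pker_dominated C e f -> 0 < t ->
  {for t, continuous f} -> is_derive t 1 (pconv 1 f) (f t).
Proof.
move=> e0 fC t0 cf; have tu : t < t + 1 by lra.
have iu := pker_dominated_integrable (t + 1) e0 fC.
have [D E] := continuous_FTC1_closed tu iu t0 cf.
rewrite (_ : pconv 1 f = fun x => \int[mu]_(s in `[0, x]) f s); last first.
  by apply/funext => x; exact: pconv1E e0 fC.
by apply: DeriveDef; [exact: D|rewrite -derive1E; exact: E].
Qed.

Lemma cvg_pconv_at_right0 C e b f : 0 < b -> 0 < e -> 1 < b + e ->
  pker_dominated C e f -> pconv b f t @[t --> 0^'+] --> (0 : R).
Proof.
move=> b0 e0 be fC; apply/norm_cvg0P.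
have p0 : 0 < b + e - 1 by rewrite subr_gt0.
have H : \forall x \near 0^'+,
    cst 0 x <= `|pconv b f x| <= C * beta b e * x `^ (b + e - 1).
  near=> x; rewrite normr_ge0 /=.
  by rewrite (le_trans (pconv_bound x b0 e0 fC)) // pkerE.
apply: (squeeze_cvgr H); first exact: cvg_cst.
rewrite -[X in _ --> X](mulr0 (C * beta b e)); apply: cvgMl_tmp.
exact: powR_cvg0.
Unshelve. all: by end_near. Qed.

Lemma derive0_eq0_itvoo T f :
  (forall t, 0 < t < T -> is_derive t 1 f 0) ->
  f t @[t --> 0^'+] --> (0 : R) -> forall t, 0 < t < T -> f t = 0.
Proof.
move=> df f0 t /andP[t0 tT].
have fc s : 0 < s -> s < t -> f s = f t.
  move=> s0 st.
  have [] := @MVT _ f (cst 0) s t st.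
  - move=> x; rewrite in_itv /= => /andP[sx xt]; apply: df.
    by rewrite (lt_trans s0) // (lt_trans xt).
  - apply: derivable_within_continuous => x; rewrite in_itv /= => /andP[sx xt].
    by have := df x; rewrite (lt_le_trans s0 sx) (le_lt_trans xt tT) => /(_ isT) [].
  - by move=> x _; rewrite /cst mul0r => /eqP; rewrite subr_eq0 => /eqP.
apply/esym; have : f x @[x --> 0^'+] --> f t.
  apply: (@cvg_trans _ (cst (f t) x @[x --> 0^'+])); last exact: cvg_cst.
  by apply: near_eq_cvg; near=> x; rewrite /= fc.
by move/(cvg_unique _ f0); apply.
Unshelve. all: by end_near. Qed.

(** As [f] may be singular at 0, the formula comes from comparison on (0, T): the difference has
    zero derivative there and tends to 0 at 0. *)
Lemma pconv1_of_derive C e f g T : 0 < e -> pker_dominated C e f ->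
  (forall t, 0 < t < T -> {for t, continuous f}) ->
  g t @[t --> 0^'+] --> (0 : R) ->
  (forall t, 0 < t < T -> is_derive t 1 g (f t)) ->
  forall t, 0 < t < T -> g t = pconv 1 f t.
Proof.
move=> e0 fC cf g0 dg t tT; apply/eqP; rewrite -subr_eq0; apply/eqP.
apply: (derive0_eq0_itvoo (T := T) (f := fun t => g t - pconv 1 f t)) => //.
  move=> s sT; rewrite -(subrr (f s)); apply: is_deriveB; first exact: dg.
  have /andP[s0 _] := sT; exact: is_derive_pconv1 e0 fC s0 (cf _ sT).
rewrite -[X in _ --> X](subrr (0 : R)); apply: cvgB => //.
have e1 : 1 < 1 + e by rewrite ltrDl.
exact: cvg_pconv_at_right0 ltr01 e0 e1 fC.
Qed.

(** Writing g = I^1 f gives I^b g = I^b I^1 f = I^1 I^b f, and I^b f is continuous on (0, T). The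
    vanishing of [g] at 0 removes the boundary term. *)
Lemma is_derive_pconv C e b f g T : 0 < b -> 0 < e -> pker_dominated C e f ->
  (forall t, 0 < t < T -> {for t, continuous f}) ->
  g t @[t --> 0^'+] --> (0 : R) ->
  (forall t, 0 < t < T -> is_derive t 1 g (f t)) ->
  forall t, 0 < t < T ->
    is_derive t 1 (pconv b (g \_ `]0, T[)) (pconv b f t).
Proof.
move=> b0 e0 fC cf g0 dg t /andP[t0 tT].
have fC' := pker_dominated_pconv b0 e0 fC.
have be0 : 0 < b + e by rewrite addr_gt0.
have D : is_derive t 1 (pconv 1 (pconv b f)) (pconv b f t).
  apply: (is_derive_pconv1 be0 fC' t0).
  by apply: (continuous_pconv b0 e0 fC cf); rewrite t0.
apply: (near_eq_is_derive _ D).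
near=> x.
have xT : x < T by near: x; exact: lt_nbhsl.
(* Both composites equal the integral of order 1 + b times the same beta value. *)
rewrite (pconv_pconv _ ltr01 b0 e0 fC) betaC addrC -(pconv_pconv _ b0 ltr01 e0 fC).
apply: eq_pconv => s sx; rewrite /patch; case: ifPn.
  rewrite inE /= in_itv /= => sT.
  by rewrite -(pconv1_of_derive e0 fC cf g0 dg).
rewrite notin_setE /= in_itv /= (lt_trans sx xT) andbT => /negP.
rewrite -leNgt => s0.
by rewrite (pker_dominated_le0 (pker_dominated_pconv ltr01 e0 fC)).
Unshelve. all: by end_near. Qed.
End FTC.

(** * A weakly singular Volterra inequality *)

Section GammaVolterra.
Context {R : realType}.
Notation mu := (@lebesgue_measure R).
Implicit Types b d e C T r s t x : R.
Implicit Types f g : R -> R.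

Lemma measurable_expRN : measurable_fun [set: R] (fun s : R => expR (- s)).
Proof. by apply: measurableT_comp => //; exact: oppr_measurable. Qed.

Lemma measurable_expRM l : measurable_fun [set: R] (fun s : R => expR (l * s)).
Proof. by apply: measurableT_comp => //; exact: mulrl_measurable. Qed.

Lemma measurable_gamma_integrand d :
  measurable_fun [set: R] (fun s => pker d s * expR (- s)).
Proof.
apply: measurable_funM; [exact: measurable_pker|exact: measurable_expRN].
Qed.

Lemma integral_expRN : (\int[mu]_(s in `[0%R, +oo[) (expR (- s))%:E = 1)%E.
Proof.
have := integral_exponential_pdf (@ltr01 R); rewrite /exponential_pdf => <-.
rewrite integral_mkcond; apply: eq_integral => s _.
by rewrite /patch; case: ifPn => // _; rewrite mul1r mulN1r.
Qed.

Lemma Gamma_pker d :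
  Gamma d = \int[mu]_s (pker d s * expR (- s)).
Proof.
rewrite /Gamma Rintegral_mkcond; apply: eq_Rintegral => s _.
rewrite /patch; case: ifPn; rewrite ?inE ?notin_setE /= in_itv /= andbT.
  by move=> s0; rewrite pkerE.
by move=> /negP; rewrite -leNgt => s0; rewrite pker_le0 // mul0r.
Qed.

(** The majorant is the bare power on (0, 1] and the bare exponential beyond 1, where [d <= 1] makes
    the power at most 1. *)
Lemma gamma_lty d : 0 < d <= 1 ->
  (\int[mu]_s (pker d s * expR (- s))%:E < +oo)%E.
Proof.
move=> /andP[d0 d1]; pose E s : R := ((fun s => expR (- s)) \_ `[0, +oo[) s.
have P0 x : 0 <= pker01 d x :> R by rewrite mulr_ge0 // ?pker_ge0 // indicE.
have E0 s : 0 <= E s by rewrite /E /patch; case: ifPn => // _; exact: expR_ge0.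
have mE : measurable_fun [set: R] E.
  apply/(measurable_restrictT _ _).1 => //; apply: measurable_funTS.
  exact: measurable_expRN.
apply: (@le_lt_trans _ _ (\int[mu]_s ((pker01 d s)%:E + (E s)%:E))%E).
  apply: ge0_le_integral => //.
  - by move=> x _; rewrite lee_fin mulr_ge0 // ?pker_ge0 // expR_ge0.
  - by apply/measurable_EFinP; exact: measurable_gamma_integrand.
  - by apply/measurable_EFinP/measurable_funD => //; exact: measurable_pker01.
  move=> s _; rewrite -EFinD lee_fin; have [s0|s0] := leP s 0.
    by rewrite pker_le0 // mul0r addr_ge0.
  have [s1|s1] := leP s 1.
    rewrite ler_wpDr // /pker01 indicE mem_set /= ?in_itv /= ?s0 // mulr1.
    by rewrite ler_piMr ?pker_ge0 // -expR0 ler_expR oppr_le0 ltW.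
  rewrite ler_wpDl // /E /patch mem_set /=; last by rewrite in_itv /= andbT ltW.
  rewrite ler_piMl ?expR_ge0 // pkerE // -[d - 1]opprK powRN invf_le1 ?powR_gt0 //.
  have d2 : 0 <= - (d - 1) by lra.
  have := ge0_ler_powR d2 _ _ (ltW s1); rewrite powR1; apply;
    by rewrite nnegrE // ltW.
rewrite ge0_integralD //; last first.
- exact/measurable_EFinP.
- by move=> s _; rewrite lee_fin.
- by apply/measurable_EFinP; exact: measurable_pker01.
- by move=> s _; rewrite lee_fin.
apply: lte_add_pinfty; first exact: integral_pker01_lty.
rewrite (_ : \int[mu]_s (E s)%:E = \int[mu]_(s in `[0%R, +oo[) (expR (- s))%:E)%E.
  by rewrite integral_expRN ltry.
rewrite [RHS]integral_mkcond; apply: eq_integral => s _.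
by rewrite /E /patch; case: ifP.
Qed.

Lemma GammaE d : 0 < d <= 1 ->
  (\int[mu]_s (pker d s * expR (- s))%:E = (Gamma d)%:E)%E.
Proof.
move=> d01; rewrite Gamma_pker /Rintegral fineK // ge0_fin_numE ?gamma_lty //.
by apply: integral_ge0 => x _; rewrite lee_fin mulr_ge0 // ?pker_ge0 // expR_ge0.
Qed.

Lemma Gamma_gt0 d : 0 < d <= 1 -> 0 < Gamma d.
Proof.
move=> d01; have /andP[d0 d1] := d01.
suff : ((expR (-1))%:E <= (Gamma d)%:E)%E.
  by rewrite lee_fin; apply: lt_le_trans; exact: expR_gt0.
rewrite -GammaE //.
have -> : ((expR (-1))%:E =
    \int[mu]_x ((expR (-1))%:E * (\1_(`]0%R, 1%R[%classic : set R) x)%:E))%E.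
  rewrite ge0_integralZl_EFin ?expR_ge0 //; last first.
    by apply/measurable_EFinP; exact: measurable_indic.
  rewrite integral_indic //= setIT lebesgue_measure_itv /= lte_fin ltr01.
  by rewrite -EFinB subr0 mule1.
apply: ge0_le_integral => //.
- apply/measurable_EFinP; apply: measurable_funM => //; exact: measurable_indic.
- by apply/measurable_EFinP; exact: measurable_gamma_integrand.
move=> x _; rewrite -EFinM lee_fin indicE; case: (boolP (x \in _)) => [|_]; last first.
  by rewrite mulr0 mulr_ge0 // ?pker_ge0 // expR_ge0.
rewrite inE /= in_itv /= => /andP[x0 x1]; rewrite mulr1.
rewrite -[leLHS]mul1r ler_pM // ?expR_ge0 //; last by rewrite ler_expR; lra.
rewrite pkerE // -[d - 1]opprK powRN -[leLHS]invr1 lef_pV2 ?posrE ?powR_gt0 //.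
have p0 : 0 <= - (d - 1) by lra.
have := ge0_ler_powR p0 _ _ (ltW x1); rewrite powR1; apply; rewrite nnegrE //.
exact: ltW.
Qed.

(** Integrating over all s < t, not just 0 < s < t, gives a closed form after s = t - x/l. For
    functions vanishing on s <= 0 it serves as an upper bound. *)
Lemma pker_exp_conv d l t : 0 < d <= 1 -> 0 < l ->
  (\int[mu]_s (pker d (t - s) * expR (l * s))%:E =
   (expR (l * t) * (l `^ (- d) * Gamma d))%:E)%E.
Proof.
move=> d01 l0; have l'0 : 0 < l^-1 by rewrite invr_gt0.
have mI : measurable_fun [set: R] (fun s => pker d (t - s) * expR (l * s)).
  by apply: measurable_pker_mul; exact: measurable_expRM.
rewrite (ge0_integral_sub t); last 2 first.
- exact/measurable_EFinP.
- by move=> s; rewrite lee_fin mulr_ge0 ?pker_ge0 ?expR_ge0.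
rewrite (ge0_integral_affine 0 l'0); last 2 first.
- apply/measurable_EFinP; apply: (measurableT_comp mI); exact: measurable_funB.
- by move=> s; rewrite lee_fin mulr_ge0 ?pker_ge0 ?expR_ge0.
have E s : ((pker d (t - (t - (l^-1 * s + 0))) * expR (l * (t - (l^-1 * s + 0))))%:E
    = (l^-1 `^ (d - 1) * expR (l * t))%:E * (pker d s * expR (- s))%:E)%E.
  rewrite addr0 opprB addrC subrK pkerM // mulrBr mulrA divff ?gt_eqF // mul1r.
  by rewrite expRD -EFinM; congr EFin; ring.
under eq_integral do rewrite E.
rewrite ge0_integralZl_EFin //; last 3 first.
- by move=> s _; rewrite lee_fin mulr_ge0 ?pker_ge0 ?expR_ge0.
- by apply/measurable_EFinP; exact: measurable_gamma_integrand.
- by rewrite mulr_ge0 ?powR_ge0 ?expR_ge0.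
rewrite GammaE // -!EFinM; congr EFin.
have -> : l `^ (- d) = l^-1 * l^-1 `^ (d - 1).
  have /andP[d0 _] := d01.
  by rewrite mulr_powRB1 // ?ltW // -powR_inv1 ?ltW // -powRrM mulN1r.
by ring.
Qed.

(** Each application of the inequality halves the constant in a bound by a multiple of exp(l t), so
    [v] is below M 2^(-n) exp(l t) for every n. *)
Lemma weak_volterra A M d T v : 0 < d <= 1 -> 0 <= A -> pker_dominated M 1 v ->
  (forall t, 0 < t < T -> `|v t| <= A * pconv d (fun s => `|v s|) t) ->
  forall t, 0 < t < T -> v t = 0.
Proof.
move=> d01 A0 vM vle; have /andP[d0 d1] := d01; have M0 := pker_dominated_ge0 vM.
have G0 := Gamma_gt0 d01.
(* With l = D^(1/d) one has l^(-d) = 1/D, hence A Gamma(d) l^(-d) <= 1/2; the added 1 keeps [D]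
   positive when [A = 0]. *)
pose D := 2 * (A * Gamma d) + 1.
have D0 : 0 < D by rewrite ltr_wpDl // !mulr_ge0 // ltW.
pose l := D `^ d^-1; have l0 : 0 < l by exact: powR_gt0.
have ld : A * (l `^ (- d) * Gamma d) <= 2^-1.
  rewrite /l -powRrM mulrN mulVf ?gt_eqF // powR_inv1 ?(ltW D0) //.
  rewrite mulrCA mulrC ler_pdivrMr // /D; lra.
(* As pconv d (exp (l .)) <= l^(-d) Gamma(d) exp (l .), the choice of l makes
   the right-hand side a contraction by 1/2 for the weight exp (l .). *)
have half K : 0 <= K -> (forall t, 0 < t < T -> `|v t| <= K * expR (l * t)) ->
    forall t, 0 < t < T -> `|v t| <= K / 2 * expR (l * t).
  move=> K0 vK t tT; apply: le_trans (vle _ tT) _.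
  have vM' : pker_dominated M 1 (fun s => `|v s|).
    split; first by apply: measurableT_comp => //; case: vM.
    by move=> x; rewrite normr_id; case: vM.
  have iv := integrable_pconv t d0 ltr01 vM'.
  suff h : pconv d (fun s => `|v s|) t <= K * (expR (l * t) * (l `^ (- d) * Gamma d)).
    apply: le_trans (ler_wpM2l A0 h) _.
    rewrite (_ : A * _ = K * expR (l * t) * (A * (l `^ (- d) * Gamma d))); last first.
      by ring.
    rewrite [leRHS](_ : _ = K * expR (l * t) * 2^-1); last by ring.
    by rewrite ler_wpM2l ?mulr_ge0 ?expR_ge0.
  rewrite -lee_fin EFinM -pker_exp_conv // /pconv /Rintegral fineK; last first.
    exact: integrable_fin_num.
  rewrite -ge0_integralZl_EFin //; last 2 first.
  - by move=> s _; rewrite lee_fin mulr_ge0 ?pker_ge0 ?expR_ge0.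
  - apply/measurable_EFinP; apply: measurable_pker_mul.
    exact: measurable_expRM.
  apply: ge0_le_integral => //.
  - by move=> s _; rewrite lee_fin mulr_ge0 ?pker_ge0.
  - exact: measurable_int iv.
  - apply: measurable_funeM; apply/measurable_EFinP; apply: measurable_pker_mul.
    exact: measurable_expRM.
  move=> s _; rewrite -EFinM lee_fin mulrCA.
  have [ts|st] := leP t s; first by rewrite pker_le0 ?subr_le0 // !mul0r.
  rewrite ler_wpM2l ?pker_ge0 //; have [s0|s0] := leP s 0.
    by rewrite (pker_dominated_le0 vM) // normr0 mulr_ge0 ?expR_ge0.
  by apply: vK; rewrite s0 (lt_trans st); case/andP: tT.
have vn n t : 0 < t < T -> `|v t| <= M * 2^-1 ^+ n * expR (l * t).
  elim: n t => [|n IH] t tT.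
    rewrite expr0 mulr1; case: vM => _ /(_ t) /le_trans; apply.
    rewrite ler_wpM2l // pkerE ?subrr ?powRr0; last by case/andP: tT.
    by rewrite -expR0 ler_expR mulr_ge0 // ltW //; case/andP: tT.
  rewrite exprSr mulrA; apply: half => //.
  by rewrite mulr_ge0 // exprn_ge0.
move=> t tT; apply/eqP/negPn/negP => vt0.
have vt : 0 < `|v t| by rewrite normr_gt0.
have B0 : 0 <= M * expR (l * t) / `|v t| by rewrite divr_ge0 ?mulr_ge0 ?expR_ge0.
(* A value [v t] different from 0 would bound all powers of 2, contradicting the Archimedean
   property. *)
have := archi_boundP B0; set n := Num.bound _ => nB.
have : M * expR (l * t) / `|v t| < 2 ^+ n.
  by apply: lt_le_trans nB _; rewrite -natrX ler_nat ltnW // ltn_expl.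
rewrite ltr_pdivrMr // ltNge => /negP; apply.
have := vn n _ tT; rewrite mulrAC exprVn ler_pdivlMr ?exprn_gt0 // mulrC.
by [].
Qed.
End GammaVolterra.

(** * The homogeneous fractional equation has only the trivial solution *)

Section Uniqueness.
Context {R : realType}.
Notation mu := (@lebesgue_measure R).
Implicit Types b d e C T r s t x : R.
Implicit Types f g : R -> R.

Lemma restrictoo_in f T t : 0 < t < T -> (f \_ `]0, T[) t = f t.
Proof. by move=> tT; rewrite /patch mem_set //= in_itv. Qed.

Lemma near_restrictoo f T t : 0 < t < T -> \near t, f t = (f \_ `]0, T[) t.
Proof.
move=> /andP[t0 tT]; near=> x; rewrite restrictoo_in //; apply/andP; split.
  by near: x; exact: lt_nbhsr.
by near: x; exact: lt_nbhsl.
Unshelve. all: by end_near. Qed.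

Lemma continuous_restrictoo f T t : 0 < t < T -> {for t, continuous f} ->
  {for t, continuous (f \_ `]0, T[)}.
Proof.
move=> tT cf; suff : (f \_ `]0, T[) x @[x --> t] --> (f \_ `]0, T[) t by [].
rewrite restrictoo_in //; apply: cvg_trans cf; apply: near_eq_cvg.
exact: near_restrictoo.
Qed.

Lemma pker_dominated_restrictoo C e f T : 0 <= C ->
  (forall t, 0 < t < T -> {for t, continuous f}) ->
  (forall t, 0 < t < T -> `|f t| <= C * pker e t) ->
  pker_dominated C e (f \_ `]0, T[).
Proof.
move=> C0 cf fle; split.
  apply/(measurable_restrictT _ _).1 => //.
  apply: open_continuous_measurable_fun => // t; rewrite inE /= in_itv /=.
  exact: cf.
move=> x; rewrite /patch; case: ifPn; last by rewrite normr0 mulr_ge0 ?pker_ge0.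
by rewrite inE /= in_itv /=; exact: fle.
Qed.

Lemma pker_le d d' T x : d <= d' -> 0 < T -> x <= T ->
  pker d' x <= T `^ (d' - d) * pker d x.
Proof.
move=> dd T0 xT; have [x0|x0] := leP x 0; first by rewrite !pker_le0 // mulr0.
rewrite !pkerE // (_ : d' - 1 = (d' - d) + (d - 1)); last by ring.
rewrite powRD; last by rewrite (gt_eqF x0) implybT.
by rewrite ler_wpM2r ?powR_ge0 // ge0_ler_powR // ?subr_ge0 // nnegrE ltW.
Qed.

(** On a bounded interval a kernel of higher order is at most a constant times one of lower order,
    so several fractional integrals can be bounded by the one of smallest order. *)
Lemma pconv_le_norm M e d d' T v t : 0 < d -> d <= d' -> 0 < e -> 0 < T -> t <= T ->
  pker_dominated M e v ->
  `|pconv d' v t| <= T `^ (d' - d) * pconv d (fun s => `|v s|) t.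
Proof.
move=> d0 dd e0 T0 tT vM.
have d'0 : 0 < d' := lt_le_trans d0 dd.
have vM' : pker_dominated M e (fun s => `|v s|).
  split; first by apply: measurableT_comp => //; case: vM.
  by move=> x; rewrite normr_id; case: vM.
have iv' := integrable_pconv t d0 e0 vM'.
have iv := integrable_pconv t d'0 e0 vM.
apply: le_trans (le_normr_Rintegral measurableT iv) _.
rewrite /pconv -RintegralZl //.
apply: le_Rintegral => //.
- exact: integrable_norm iv.
- exact: (integrableZl measurableT (T `^ (d' - d)) iv').
move=> s _; have [s0|s0] := leP s 0.
  by rewrite (pker_dominated_le0 vM) // mulr0 normr0 !mulr0.
rewrite normrM ger0_norm ?pker_ge0 // mulrA ler_wpM2r // pker_le //.
by rewrite lerBlDr (le_trans tT) // lerDl ltW.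
Qed.

Lemma pconv_eq0 b f t : (forall s, s < t -> f s = 0) -> pconv b f t = 0.
Proof.
move=> f0; rewrite (@eq_pconv _ b f (cst 0)) //.
by rewrite /pconv; under eq_Rintegral do rewrite mulr0; rewrite Rintegral_cst // mul0r.
Qed.

(** In the application [c] is gamma, [bt i] is n0 - alpha_i and [U] is u. The orders [bt i - c] are
    then alpha_0 - alpha_i, smallest at i = 1, and every term is compared with that one. *)
Lemma fractional_equation_trivial T C A (c : R) (m : nat) (bt : nat -> R)
    (a : nat -> R -> R) (U : R -> R) :
  0 < T -> 0 < c < 1 -> bt 0%N = c ->
  (forall i, (1 <= i <= m)%N -> c < bt 1%N <= bt i) ->
  (forall i, (1 <= i <= m)%N -> bt i < 1) ->
  0 <= A -> (forall i, (1 <= i <= m)%N -> forall t, 0 < t < T -> `|a i t| <= A) ->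
  pker_dominated C (1 - c) U ->
  (forall t, 0 < t < T -> (Gamma c)^-1 * pconv c U t =
     - \sum_(1 <= i < m.+1) a i t * ((Gamma (bt i))^-1 * pconv (bt i) U t)) ->
  forall t, 0 < t < T -> pconv 1 U t = 0.
Proof.
move=> T0 /andP[c0 c1] bt0 btlt bt1 A0 aA UC eqn.
have c'0 : 0 < 1 - c by lra.
have G0 : 0 < Gamma c by apply: Gamma_gt0; rewrite c0 ltW.
have C0 := pker_dominated_ge0 UC.
have vD := pker_dominated_pconv c0 c'0 UC; rewrite subrKC in vD.
pose v := pconv c U \_ `]0, T[.
set M := C * _ in vD.
have vM : pker_dominated M 1 v.
  split.
    by apply/(measurable_restrictT _ _).1 => //; apply: measurable_funTS; case: vD.
  move=> x; rewrite /v /patch; case: ifPn => _; first by case: vD.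
  by rewrite normr0 mulr_ge0 ?pker_ge0 // (pker_dominated_ge0 vD).
have vE b t : t <= T -> pconv b v t = pconv b (pconv c U) t.
  move=> tT; apply: eq_pconv => s st; have [s0|s0] := leP s 0.
    by rewrite (pker_dominated_le0 vM) // (pker_dominated_le0 vD).
  by rewrite /v restrictoo_in // s0 (lt_le_trans st).
have v0 : forall t, 0 < t < T -> v t = 0.
  (* Without terms on the right there is no smallest order, but the equation itself says v = 0. *)
  case: m => [|m] in btlt bt1 aA eqn *.
    move=> t tT; rewrite /v restrictoo_in //; have := eqn _ tT.
    rewrite big_geq // oppr0 => /eqP; rewrite mulf_eq0 invr_eq0 gt_eqF //=.
    by move=> /eqP.
  have /andP[cd _] := btlt 1%N isT.
  pose dl i := bt i - c.
  have d0 : 0 < dl 1%N by rewrite subr_gt0.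
  have d1 : dl 1%N <= 1 by rewrite /dl; have := bt1 1%N isT; lra.
  (* The factors bound the coefficient, normalise the integral, undo the beta value of the semigroup
     law and pay for the passage to the smallest order. *)
  pose K i := A * ((Gamma (bt i))^-1 * ((beta (dl i) c)^-1 * T `^ (dl i - dl 1%N))).
  have H i : (1 <= i <= m.+1)%N -> [/\ 0 < bt i <= 1, 0 < dl i <= 1 & dl 1%N <= dl i].
    move=> im; have /andP[_ b1i] := btlt i im; have := bt1 i im => bi1.
    have bi0 : 0 < bt i by rewrite (lt_trans c0) // (lt_le_trans cd).
    by rewrite /dl; split; [rewrite bi0 ltW|apply/andP; split; lra|lra].
  have K0 i : (1 <= i <= m.+1)%N -> 0 <= K i.
    move=> /H[b01 d01 _]; rewrite /K !mulr_ge0 ?powR_ge0 // invr_ge0.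
      exact/ltW/Gamma_gt0.
    exact: beta_ge0.
  apply: (@weak_volterra _ (Gamma c * \sum_(1 <= i < m.+2) K i) M (dl 1%N) T v).
  - by rewrite d0.
  - rewrite mulr_ge0 ?(ltW G0) // big_nat_cond sumr_ge0 // => i.
    by rewrite andbT ltnS => /K0.
  - exact: vM.
  move=> t tT; have /andP[t0 tT'] := tT; rewrite {1}/v restrictoo_in //.
  have -> : pconv c U t = Gamma c * ((Gamma c)^-1 * pconv c U t).
    by rewrite mulrA divff ?mul1r // gt_eqF.
  rewrite eqn // normrM (gtr0_norm G0) -mulrA ler_wpM2l ?(ltW G0) // normrN.
  rewrite mulr_suml; apply: le_trans (ler_norm_sum _ _ _) _.
  rewrite big_nat_cond [leRHS]big_nat_cond; apply: ler_sum => i.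
  rewrite andbT ltnS => im; have [b01 d01 dle] := H i im.
  have /andP[d'0 d'1] := d01.
  have B0 : 0 < beta (dl i) c by apply: beta_gt0 => //; rewrite c0 ltW.
  have -> : pconv (bt i) U t = (beta (dl i) c)^-1 * pconv (dl i) v t.
    rewrite vE ?ltW // (pconv_pconv _ d'0 c0 c'0 UC) subrK mulrA mulVf ?mul1r //.
    by rewrite gt_eqF.
  have Gi : 0 < Gamma (bt i) by exact: Gamma_gt0.
  rewrite !normrM normfV (gtr0_norm Gi) normfV (gtr0_norm B0) /K -!mulrA.
  apply: ler_pM => //; first by rewrite !mulr_ge0 ?invr_ge0 ?(ltW Gi) ?(ltW B0).
    exact: aA.
  rewrite ler_wpM2l ?invr_ge0 ?(ltW Gi) // ler_wpM2l ?invr_ge0 ?(ltW B0) //.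
  by apply: pconv_le_norm vM => //; exact: ltW.
move=> t /andP[t0 tT]; have B0 : 0 < beta (1 - c) c.
  by apply: beta_gt0; apply/andP; split; lra.
have := pconv_pconv t c'0 c0 c'0 UC; rewrite subrK -vE ?ltW // pconv_eq0.
  by move=> /esym/eqP; rewrite mulf_eq0 gt_eqF //= => /eqP.
move=> s st; have [s0|s0] := leP s 0; first exact: pker_dominated_le0 vM s0.
by apply: v0; rewrite s0 (lt_trans st).
Qed.

End Uniqueness.

(** * Derivatives relative to an interval *)

Section RelativeDerivative.
Context {R : realType}.
Implicit Types (f g : R -> R) (T t l : R) (A : set R).

Lemma near_dnbhs0 t (P : R -> Prop) :
  (\forall h \near (0 : R)^', P h) <-> (\forall s \near t^', P (s - t)).
Proof.
split => H.
  have H' : \forall h \near (0 : R), h != 0 -> P h by exact: H.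
  rewrite (near_shift t) in H'; apply: filterS H' => s /= H' st.
  by move: H'; rewrite sub0r; apply; rewrite subr_eq0.
have H' : \forall s \near t, s != t -> P (s - t) by exact: H.
rewrite (near_shift (0 : R)) in H'; apply: filterS H' => h /= H' h0.
by move: H'; rewrite subr0 addrK; apply; rewrite -subr_eq0 addrK.
Qed.

Lemma is_derive_slope f t l :
  is_derive t 1 f l <-> (f s - f t) / (s - t) @[s --> t^'] --> l.
Proof.
pose D (h : R) := h^-1 *: ((f \o shift t) (h *: (1 : R)) - f t).
have DE (s : R) : D (s - t) = (f s - f t) / (s - t).
  by rewrite /D /= [_%:A]mulr1 subrK [LHS]mulrC.
have E : D h @[h --> 0^'] --> l <-> (f s - f t) / (s - t) @[s --> t^'] --> l.
  split => /cvgrPdist_lt H; apply/cvgrPdist_lt => e /H.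
    by move=> /(near_dnbhs0 t); apply: filterS => s; rewrite DE.
  move=> {}H; apply/(near_dnbhs0 t); move: H; apply: filterS => s; by rewrite DE.
split => [[df dl]|/E H]; first by apply/E; rewrite -dl; exact: df.
by apply: DeriveDef; [apply/cvg_ex; exists l|exact/cvg_lim].
Qed.

(** Existence and value in one statement: [deriv_in] alone says nothing when the quotient
    diverges. *)
Definition has_deriv_in A f t l : Prop :=
  (f s - f t) / (s - t) @[s --> within A t^'] --> l.

Lemma has_deriv_in_is_derive A f t l : is_derive t 1 f l -> has_deriv_in A f t l.
Proof.
move=> /is_derive_slope; rewrite /has_deriv_in; apply: cvg_trans.
by apply: cvg_app; exact: cvg_within.
Qed.

Lemma is_derive_has_deriv_in A f t l : (A^°)%classic t ->
  has_deriv_in A f t l -> is_derive t 1 f l.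
Proof.
move=> At H; apply/is_derive_slope; apply: cvg_trans H; apply: cvg_app.
move=> P; rewrite /within /= => h.
have : \forall s \near t^', A s by exact: (@cvg_within _ (nbhs t)).
by move=> hA; move: hA h; apply: filterS2 => s As; exact.
Qed.

(** Properness makes limits unique, so that [deriv_in] is determined. Points of [0, T] accumulate at
    t from the right if t < T, from the left if t = T. *)
Lemma proper_within_itvcc T t : 0 < T -> 0 <= t <= T ->
  ProperFilter (within `[0, T] t^').
Proof.
move=> T0 /andP[t0 tT]; split; last exact: within_filter.
rewrite /within /= => H.
have [tT'|Tt] := ltP t T.
  have : t^'+ (fun _ : R => False); last by exact: filter_not_empty.
  have Hr : t^'+ [set s : R | `[0, T]%classic s -> False].
    have H' : nbhs t (fun s => s != t -> `[0, T]%classic s -> False) by exact: H.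
    rewrite /at_right /within /=; apply: filterS H' => s h /= ts; apply: h.
    by rewrite gt_eqF.
  near=> s; have : `[0, T]%classic s; last by near: s.
  by rewrite /= in_itv /= (le_trans t0) //= ltW.
have : t^'- (fun _ : R => False); last by exact: filter_not_empty.
have Hr : t^'- [set s : R | `[0, T]%classic s -> False].
  have H' : nbhs t (fun s => s != t -> `[0, T]%classic s -> False) by exact: H.
  rewrite /at_left /within /=; apply: filterS H' => s h /= ts; apply: h.
  by rewrite lt_eqF.
have t'0 : 0 < t by exact: lt_le_trans Tt.
near=> s; have : `[0, T]%classic s; last by near: s.
rewrite /= in_itv /=; apply/andP; split.
  by apply: ltW; near: s; exact: nbhs_left_gt.
by rewrite (le_trans _ tT) // ltW //; near: s; exact: nbhs_left_lt.
Unshelve. all: by end_near. Qed.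

Lemma has_deriv_inP T f t l : 0 < T -> 0 <= t <= T ->
  has_deriv_in `[0, T] f t l <->
  derivable_in `[0, T] f t /\ deriv_in `[0, T] f t = l.
Proof.
move=> T0 tT; have PF := proper_within_itvcc T0 tT; split=> [H|[H <-]]; last exact: H.
by split; [apply/cvg_ex; exists l|exact/cvg_lim].
Qed.

Lemma eq_has_deriv_in T f g t l : 0 <= t <= T ->
  (forall s, 0 <= s <= T -> f s = g s) ->
  has_deriv_in `[0, T] f t l -> has_deriv_in `[0, T] g t l.
Proof.
move=> tT fg; apply: cvg_trans; apply: near_eq_cvg; rewrite near_withinE.
by apply: nearW => s; rewrite /= in_itv /= => sT; rewrite !fg.
Qed.

Lemma has_deriv_inB A f g t l l' :
  has_deriv_in A f t l -> has_deriv_in A g t l' ->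
  has_deriv_in A (fun s => f s - g s) t (l - l').
Proof.
move=> fl gl; rewrite /has_deriv_in.
rewrite (_ : (fun s => _) = (fun s => (f s - f t) / (s - t) - (g s - g t) / (s - t))).
  by apply: cvgB.
by apply/funext => s; rewrite -mulrBl; congr (_ / _); ring.
Qed.

Lemma deriv_in_n_horner T (p : {poly R}) k t : 0 < T -> 0 <= t <= T ->
  deriv_in_n `[0, T] k (horner p) t = p^`(k).[t].
Proof.
move=> T0; elim: k t => [|k IH] t tT //=.
apply: ((@has_deriv_inP T _ t _ T0 tT).1 _).2.
apply: (@eq_has_deriv_in T (horner p^`(k))) => //.
  by move=> s sT; rewrite -IH.
by apply: has_deriv_in_is_derive; exact: is_derive_poly.
Qed.

Lemma has_deriv_in_horner T (p : {poly R}) k t : 0 < T -> 0 <= t <= T ->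
  has_deriv_in `[0, T] (deriv_in_n `[0, T] k (horner p)) t p^`(k.+1).[t].
Proof.
move=> T0 tT; apply: (@eq_has_deriv_in T (horner p^`(k))) => //.
  by move=> s sT; rewrite deriv_in_n_horner.
by rewrite derivnS; apply: has_deriv_in_is_derive; exact: is_derive_poly.
Qed.

Lemma Cinfty_horner T (p : {poly R}) : 0 < T -> Cinfty T (horner p).
Proof.
move=> T0 n; split => k _.
  move=> t tT; have H := @has_deriv_in_horner T p k t T0 tT.
  exact: ((has_deriv_inP _ _ T0 tT).1 H).1.
apply: (@subspace_eq_continuous _ _ R (horner p^`(k))).
  by move=> s; rewrite inE /= in_itv /= => sT; exact/esym/deriv_in_n_horner.
by apply: continuous_subspaceT => x; exact: continuous_horner.
Qed.
End RelativeDerivative.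

(** * Polynomials of degree below n0 as solutions *)

Section Polynomials.
Context {R : realType}.
Implicit Types (T t alpha gamma : R) (p : {poly R}).

Lemma frac_orderE alpha n : n%:R - 1 < alpha <= n%:R -> frac_order alpha = n.
Proof.
move=> h; rewrite /frac_order (_ : Num.ceil alpha = n%:Z) //.
by apply: ceil_def; rewrite intrB /= -!pmulrn.
Qed.

Lemma derivn_horner0 p k : p^`(k).[0] = p`_k * k`!%:R.
Proof. by rewrite horner_coef0 coef_derivn addn0 ffactnn mulr_natr. Qed.

Lemma fact_unit k : (k`!%:R : R) != 0.
Proof. by rewrite pnatr_eq0 -lt0n fact_gt0. Qed.

Lemma horner_taylor n p t : (size p <= n)%N ->
  \sum_(0 <= k < n) p^`(k).[0] / k`!%:R * t ^+ k = p.[t].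
Proof.
move=> pn; rewrite (horner_coef_wide _ pn) big_mkord; apply: eq_bigr => k _.
by rewrite derivn_horner0 mulfK // fact_unit.
Qed.

Lemma taylor_rem_horner T n p : 0 < T -> (size p <= n)%N ->
  taylor_rem T n (horner p) = fun=> 0.
Proof.
move=> T0 pn; apply/funext => t; rewrite /taylor_rem -{1}(horner_taylor t pn).
apply/eqP; rewrite subr_eq0; apply/eqP; apply: eq_bigr => k _.
by rewrite deriv_in_n_horner // lexx ltW.
Qed.

Lemma RL_integral0 alpha : RL_integral alpha (fun=> 0 : R) = fun=> 0.
Proof.
apply/funext => t; rewrite /RL_integral; case: ifP => // _.
by under eq_Rintegral do rewrite mulr0; rewrite Rintegral_cst // mul0r mulr0.
Qed.

Lemma derive1n_cst0 k : derive1n k (fun=> 0 : R) = (fun=> 0 : R).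
Proof.
elim: k => [//|k IH]; rewrite derive1nS IH.
by apply/funext => t; exact: derive1_cst.
Qed.

(** Such a polynomial is its own Taylor polynomial, and all orders share the ceiling [n], so each
    Caputo derivative acts on 0 and both sides vanish. *)
Lemma fde_solution_horner gamma T m (alpha_ : nat -> R) a p n : 0 < T ->
  (forall i, (i <= m)%N -> frac_order (alpha_ i) = n) -> (size p <= n)%N ->
  fde_solution gamma T m alpha_ a (horner p).
Proof.
move=> T0 fo pn; have P0 t : p^`(n).[t] = 0 by rewrite derivn_poly0 ?horner0.
have C0 i t : (i <= m)%N -> caputo T (alpha_ i) (horner p) t = 0.
  move=> im; rewrite /caputo /RL_derivative fo // taylor_rem_horner //.
  by rewrite RL_integral0 derive1n_cst0.
split.
- rewrite fo //; split.
  + exact: Cinfty_horner.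
  + move=> t /andP[t0 tT]; have tT' : 0 <= t <= T by rewrite ltW.
    have H := @has_deriv_in_horner _ T p n.-1 t T0 tT'.
    exact: ((has_deriv_inP _ _ T0 tT').1 H).1.
  + exists (cst 0); first by move=> x; exact: cst_continuous.
    move=> t /andP[t0 tT]; rewrite deriv_in_n_horner ?P0 ?mulr0 //.
    by rewrite ltW.
- move=> i im k _ t _; rewrite taylor_rem_horner ?fo // RL_integral0 derive1n_cst0.
  exact: derivable_cst.
move=> t _; rewrite C0 // big_nat_cond big1 ?oppr0 // => i.
rewrite andbT ltnS => /andP[_ im].
by rewrite C0 // mulr0.
Qed.

Lemma init_value_horner T k p : 0 < T -> init_value T k (horner p) p^`(k).[0].
Proof.
move=> T0; rewrite /init_value.
apply: (@cvg_trans _ (p^`(k).[t] @[t --> 0^'+])).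
  apply: near_eq_cvg; near=> t; rewrite deriv_in_n_horner //; apply/andP; split.
    by apply: ltW; near: t; exact: nbhs_right_gt.
  by apply: ltW; near: t; exact: nbhs_right_lt.
by apply: cvg_at_right_filter; exact: continuous_horner.
Unshelve. all: by end_near. Qed.

Lemma horner_Phi_succ (b : nat -> R) n t :
  (\poly_(k < n) (b k / k`!%:R)).[t] = \sum_(0 <= k < n) b k * Phi_succ k t.
Proof.
rewrite horner_poly big_mkord; apply: eq_bigr => k _.
by rewrite /Phi_succ mulrAC mulrA.
Qed.

Lemma Phi_succ_horner j : @Phi_succ R j = horner (j`!%:R^-1 *: 'X^j).
Proof. by apply/funext => t; rewrite /Phi_succ hornerZ hornerXn mulrC. Qed.
End Polynomials.

(** * From the differential equation to the integral equation *)

Section MainUniqueness.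
Context {R : realType}.
Implicit Types (T t c b C e : R) (f : R -> R).

Lemma within_itvcc_continuous T f t : 0 < T -> {within `[0, T], continuous f} ->
  0 < t < T -> {for t, continuous f}.
Proof.
by move=> T0 /(continuous_within_itvP _ T0)[cf _ _] tT; apply: cf; rewrite in_itv.
Qed.

Lemma within_itvcc_bounded T f : 0 < T -> {within `[0, T], continuous f} ->
  exists2 C, 0 <= C & forall t, 0 <= t <= T -> `|f t| <= C.
Proof.
move=> T0 cf; have cnf : {within `[0, T], continuous (fun x => `|f x|)}.
  move: cf => /(continuous_within_itvP _ T0)[cf f0 fT].
  apply/(continuous_within_itvP _ T0); split; [|exact: cvg_norm|exact: cvg_norm].
  by move=> x /cf; exact: cvg_norm.
have [x _ xmax] := EVT_max (ltW T0) cnf.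
by exists `|f x| => // t tT; apply: xmax; rewrite in_itv.
Qed.

(** Iterating [is_derive_pconv] moves the derivatives inside. Vanishing at 0 below order [n] is
    exactly what subtracting the Taylor polynomial provides. *)
Lemma derive1n_RL_integral T b (n : nat) (W : nat -> R -> R) : 0 < b ->
  (forall k, (k <= n)%N -> forall t, 0 < t < T -> {for t, continuous (W k)}) ->
  (forall k, (k <= n)%N ->
    exists C e, 0 < e /\ pker_dominated C e (W k \_ `]0, T[)) ->
  (forall k, (k < n)%N -> W k t @[t --> 0^'+] --> (0 : R)) ->
  (forall k, (k < n)%N -> forall t, 0 < t < T -> is_derive t 1 (W k) (W k.+1 t)) ->
  forall t, 0 < t < T ->
    derive1n n (RL_integral b (W 0%N)) t =
    (Gamma b)^-1 * pconv b (W n \_ `]0, T[) t.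
Proof.
move=> b0; elim: n => [|n IH] cW dW W0 W' t tT.
  rewrite derive1n0 /RL_integral gt_eqF // (pconv_Rintegral _ _ (T := T)) //.
  by rewrite ltW //; case/andP: tT.
have {}IH : forall t, 0 < t < T -> derive1n n (RL_integral b (W 0%N)) t =
    (Gamma b)^-1 * pconv b (W n \_ `]0, T[) t.
  by apply: IH => k kn; [exact: cW (leqW kn)|exact: dW (leqW kn)|
    exact: W0 (leqW kn)|exact: W' (leqW kn)].
have [C [e [e0 WC]]] := dW n.+1 (leqnn _).
have D : is_derive t 1 (pconv b (W n \_ `]0, T[)) (pconv b (W n.+1 \_ `]0, T[) t).
  apply: (is_derive_pconv b0 e0 WC) => //.
  - by move=> s sT; apply: continuous_restrictoo => //; exact: cW.
  - exact: W0.
  - by move=> s sT; rewrite restrictoo_in //; exact: W'.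
have {}D := is_deriveZ (Gamma b)^-1 D.
rewrite derive1nS derive1E.
have E : \near t, (fun s => (Gamma b)^-1 *: pconv b (W n \_ `]0, T[) s) t =
    derive1n n (RL_integral b (W 0%N)) t.
  near=> s; rewrite /= IH //; apply/andP; split; near: s.
    by apply: lt_nbhsr; case/andP: tT.
  by apply: lt_nbhsl; case/andP: tT.
by have [_ ->] := near_eq_is_derive E D.
Unshelve. all: by end_near. Qed.

Lemma fractional_uniqueness T (c A : R) (m n : nat) (bt : nat -> R)
    (a : nat -> R -> R) (g : R -> R) (W : nat -> R -> R) :
  0 < T -> 0 < c < 1 -> bt 0%N = c ->
  (forall i, (1 <= i <= m)%N -> c < bt 1%N <= bt i) ->
  (forall i, (1 <= i <= m)%N -> bt i < 1) ->
  0 <= A -> (forall i, (1 <= i <= m)%N -> forall t, 0 < t < T -> `|a i t| <= A) ->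
  (forall k, (k <= n)%N -> {within `[0, T], continuous (W k)}) ->
  (forall k, (k <= n)%N -> W k 0 = 0) ->
  (forall k, (k <= n)%N -> forall t, 0 < t < T -> is_derive t 1 (W k) (W k.+1 t)) ->
  {within `[0, T], continuous g} ->
  (forall t, 0 < t < T -> g t = t `^ c * W n.+1 t) ->
  (forall t, 0 < t < T -> derive1n n.+1 (RL_integral c (W 0%N)) t =
    - \sum_(1 <= i < m.+1) a i t * derive1n n.+1 (RL_integral (bt i) (W 0%N)) t) ->
  forall t, 0 < t < T -> W 0%N t = 0.
Proof.
move=> T0 /andP[c0 c1] bt0 btle bt1 A0 aA cW W0 W' cg gE eqn.
have WE t : 0 < t < T -> W n.+1 t = t `^ (- c) * g t.
  move=> tT; have /andP[t0 _] := tT.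
  by rewrite gE // powRN mulKf // gt_eqF // powR_gt0.
have W00 k : (k < n.+1)%N -> W k t @[t --> 0^'+] --> (0 : R).
  rewrite ltnS => kn; rewrite -[X in _ --> X](W0 k kn).
  by have /(continuous_within_itvP _ T0)[] := cW k kn.
have cW' k : (k <= n.+1)%N -> forall t, 0 < t < T -> {for t, continuous (W k)}.
  rewrite leq_eqVlt ltnS => /predU1P[->|kn] t tT; last first.
    exact: within_itvcc_continuous (cW k kn) tT.
  suff : W n.+1 s @[s --> t] --> W n.+1 t by [].
  rewrite WE //; apply: (@cvg_trans _ (s `^ (- c) * g s @[s --> t])).
    have /andP[t0 tT'] := tT.
    apply: near_eq_cvg; near=> s; rewrite WE //; apply/andP; split; near: s.
      exact: lt_nbhsr.
    exact: lt_nbhsl.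
  apply: (@continuousM R R (fun s => s `^ (- c)) g).
    by apply: continuous_powR_pos; case/andP: tT.
  exact: within_itvcc_continuous cg tT.
(* The exponent 1 - c encodes the singularity t^(-c); the lower derivatives are bounded and get
   exponent 1. *)
have dWn : exists C, pker_dominated C (1 - c) (W n.+1 \_ `]0, T[).
  have [C C0 gC] := within_itvcc_bounded T0 cg; exists C.
  apply: pker_dominated_restrictoo => //; first exact: cW'.
  move=> t tT; have /andP[t0 tT'] := tT.
  rewrite WE // normrM ger0_norm ?powR_ge0 // mulrC pkerE //.
  rewrite (_ : 1 - c - 1 = - c); last by ring.
  by rewrite ler_wpM2r ?powR_ge0 // gC // !ltW.
have dW k : (k <= n.+1)%N ->
    exists C e, 0 < e /\ pker_dominated C e (W k \_ `]0, T[).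
  rewrite leq_eqVlt ltnS => /predU1P[->|kn].
    by have [C dC] := dWn; exists C, (1 - c); split => //; rewrite subr_gt0.
  have [C C0 WC] := within_itvcc_bounded T0 (cW k kn); exists C, 1; split => //.
  apply: pker_dominated_restrictoo => //; first by apply: cW'; exact: leqW.
  move=> t /andP[t0 tT]; rewrite pkerE // subrr powRr0 mulr1 WC //.
  by rewrite !ltW.
have RLE b t : 0 < b -> 0 < t < T -> derive1n n.+1 (RL_integral b (W 0%N)) t =
    (Gamma b)^-1 * pconv b (W n.+1 \_ `]0, T[) t.
  by move=> b0; exact: derive1n_RL_integral.
have [C dC] := dWn.
have U0 t : 0 < t < T -> pconv 1 (W n.+1 \_ `]0, T[) t = 0.
  apply: (fractional_equation_trivial T0 _ bt0 btle bt1 A0 aA dC).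
    by rewrite c0.
  move=> s sT; rewrite -RLE // eqn //; congr (- _); apply: eq_big_nat => i.
  rewrite ltnS => im; rewrite RLE //.
  by have /andP[h1 h2] := btle i im; rewrite (lt_trans c0) // (lt_le_trans h1).
have Wn t : 0 < t < T -> W n t = 0.
  move=> tT; rewrite -(U0 t tT); have c'0 : 0 < 1 - c by rewrite subr_gt0.
  apply: (pconv1_of_derive c'0 dC _ _ _ tT).
  - by move=> s sT; apply: continuous_restrictoo => //; exact: cW'.
  - exact: W00.
  - by move=> s sT; rewrite restrictoo_in //; exact: W'.
(* Descending from order n: each function has zero derivative and limit 0 at the origin. *)
have Wk j : (j <= n)%N -> forall t, 0 < t < T -> W (n - j)%N t = 0.
  elim: j => [|j IH] jn t tT; first by rewrite subn0 Wn.
  apply: (derive0_eq0_itvoo (T := T)) => // [s sT|].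
    have := W' (n - j.+1)%N (leq_subr _ _) s sT.
    by rewrite subnSK // IH // ltnW.
  by apply: W00; rewrite ltnS leq_subr.
by move=> t tT; rewrite -(subnn n) Wk.
Unshelve. all: by end_near. Qed.
End MainUniqueness.

(** * The initial value problem *)

Lemma fde_solution_unique (R : realType) (T : R) (m n : nat) (alpha : nat -> R)
    (gamma : R) (a : nat -> R -> R) (b : nat -> R) (z : R -> R) :
  0 < T -> 0 < gamma < 1 -> n.+1%:R - alpha 0%N = gamma ->
  (forall i, (i <= m)%N -> frac_order (alpha i) = n.+1) ->
  (forall i, (1 <= i <= m)%N -> alpha i <= alpha 1%N < alpha 0%N) ->
  (forall i, (1 <= i <= m)%N -> n%:R < alpha i) ->
  (forall i, (1 <= i <= m)%N -> {within `[0, T], continuous (a i)}) ->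
  fde_solution gamma T m alpha a z ->
  (forall k, (k <= n)%N -> init_value T k z (b k)) ->
  forall t, 0 <= t <= T -> z t = \sum_(0 <= k < n.+1) b k * Phi_succ k t.
Proof.
move=> T0 g01 gE fo ale agt ca [[zC dz [g cg gz]] _ eqn] zb.
rewrite fo //= in zC dz gz; have [dzC czC] := zC.
pose p : {poly R} := \poly_(k < n.+1) (b k / k`!%:R).
have sp : (size p <= n.+1)%N by exact: size_poly.
have p0 k : (k <= n)%N -> p^`(k).[0] = b k.
  by move=> kn; rewrite derivn_horner0 coef_poly ltnS kn divfK // fact_unit.
have pE t : p.[t] = \sum_(0 <= k < n.+1) b k * Phi_succ k t.
  exact: horner_Phi_succ.
(* Initial values are right limits; continuity on [0, T] turns them into the values at 0 that
   [taylor_rem] uses, so the Taylor polynomial of [z] is [p]. *)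
have z0 k : (k <= n)%N -> deriv_in_n `[0, T] k z 0 = b k.
  move=> kn; have /(continuous_within_itvP _ T0)[_ c0 _] := czC k kn.
  by apply: (cvg_unique _ c0 (zb k kn)).
have remE : taylor_rem T n.+1 z = fun t => z t - p.[t].
  apply/funext => t; rewrite /taylor_rem -(horner_taylor t sp); congr (_ - _).
  by apply: eq_big_nat => k; rewrite ltnS => /andP[_ kn]; rewrite z0 // p0.
(* At order [n.+1] the polynomial contributes nothing, so [W n.+1] is the weighted derivative of
   [z]. *)
pose W k t := deriv_in_n `[0, T] k z t - p^`(k).[t].
(* The implication makes the claim hold for every natural number, as the choice principle wants; the
   sum of these bounds then serves all coefficients. *)
have A_ex i : exists C, (1 <= i <= m)%N ->
    0 <= C /\ forall t, 0 < t < T -> `|a i t| <= C.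
  case: (boolP (1 <= i <= m)%N) => [im|_]; last by exists 0.
  have [C C0 aC] := within_itvcc_bounded T0 (ca i im); exists C => _; split => //.
  by move=> t /andP[t0 tT]; rewrite aC // !ltW.
have /choice[A HA] := A_ex.
have W0E : W 0%N = fun t => z t - p.[t] by [].
have rl i t : (i <= m)%N -> caputo T (alpha i) z t =
    derive1n n.+1 (RL_integral (n.+1%:R - alpha i) (W 0%N)) t.
  by move=> im; rewrite /caputo /RL_derivative (fo i im) remE W0E.
have W0 : forall t, 0 < t < T -> W 0%N t = 0.
  apply: (@fractional_uniqueness _ T gamma (\sum_(1 <= i < m.+1) A i) m n
    (fun i => n.+1%:R - alpha i) a g) => //.
  - move=> i im; have /andP[h1 h2] := ale i im.
    by rewrite -gE ltrD2l ltrN2 h2 /= lerD2l lerN2.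
  - by move=> i im; have := agt i im; rewrite -(natr1 n); lra.
  - rewrite big_nat_cond sumr_ge0 // => i; rewrite andbT ltnS => im.
    by have [] := HA i im.
  - move=> i im t tT; have [_ h] := HA i im; apply: le_trans (h t tT) _.
    rewrite (bigD1_seq i) ?mem_index_iota ?iota_uniq //= lerDl.
    rewrite big_seq_cond sumr_ge0 // => j; rewrite mem_index_iota ltnS => /andP[jm _].
    by have [] := HA j jm.
  - move=> k kn x; apply: (@continuousB _ _ (subspace `[0, T])
      (deriv_in_n `[0, T] k z) (horner p^`(k))).
      exact: czC.
    by apply: continuous_subspaceT => y; exact: continuous_horner.
  - by move=> k kn; rewrite /W z0 // p0 // subrr.
  - move=> k kn t /andP[t0 tT].
    have tT' : 0 <= t <= T by rewrite !ltW.
    apply: (@is_derive_has_deriv_in _ `[0, T]).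
      near=> s; rewrite /= in_itv /= ltW /=; last by near: s; exact: lt_nbhsr.
      by rewrite ltW //; near: s; exact: lt_nbhsl.
    apply: has_deriv_inB; last first.
      by apply: has_deriv_in_is_derive; rewrite derivnS; exact: is_derive_poly.
    apply/(has_deriv_inP _ _ T0 tT'); split => //.
    move: kn; rewrite leq_eqVlt => /predU1P[->|kn]; last exact: dzC.
    by apply: dz; rewrite t0 ltW.
  - move=> t /andP[t0 tT]; rewrite /W derivn_poly0 // horner0 subr0 gz // t0 ltW //.
  move=> t tT; rewrite -{1}gE -rl // eqn //; congr (- _); apply: eq_big_nat => i.
  by rewrite ltnS => /andP[_ im]; rewrite rl.
have zp t : 0 < t < T -> z t = p.[t].
  by move=> /W0/eqP; rewrite subr_eq0 => /eqP.
(* The equation lives on (0, T); the two end points follow from the initial value and from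
   continuity. *)
move=> t /andP[]; rewrite -pE le_eqVlt => /predU1P[<- _|t0].
  exact: etrans (z0 0%N isT) (esym (p0 0%N isT)).
rewrite le_eqVlt => /predU1P[->|tT]; last by rewrite zp // t0.
have /(continuous_within_itvP _ T0)[_ _ zT] := czC 0%N isT.
apply: (cvg_unique _ zT) => //.
apply: (@cvg_trans _ (p.[s] @[s --> T^'-])).
  apply: near_eq_cvg; near=> s; rewrite /= -zp //; apply/andP; split; near: s.
    exact: nbhs_left_gt.
  exact: nbhs_left_lt.
by apply: cvg_at_left_filter; exact: continuous_horner.
Unshelve. all: by end_near. Qed.

Theorem corollary5 (R : realType) (T : R) (hT : 0 < T)
    (m : nat) (hm : (1 <= m)%N)
    (alpha : nat -> R)
    (halpha_dec : forall i, (i < m)%N -> alpha i.+1 < alpha i)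
    (halpha_ge0 : 0 <= alpha m)
    (n0 : nat) (hn0 : n0%:R - 1 < alpha 0%N <= n0%:R)
    (gamma : R) (hgamma : gamma = n0%:R - alpha 0%N) (hgamma01 : 0 < gamma < 1)
    (a : nat -> R -> R)
    (ha : forall i, (1 <= i <= m)%N -> Cn_weighted gamma T 1 (a i))
    (hH : H_set m alpha (n0%:R - 1) = set0)
    (b : nat -> R) :
  (exists y : R -> R,
     [/\ fde_solution gamma T m alpha a y,
         forall k, (k < n0)%N -> init_value T k y (b k),
         forall z : R -> R, fde_solution gamma T m alpha a z ->
           (forall k, (k < n0)%N -> init_value T k z (b k)) ->
           forall t, 0 <= t <= T -> z t = y t &
         forall t, 0 <= t <= T ->
           y t = \sum_(0 <= j < n0) b j * Phi_succ j t]) /\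
  canonical_fundamental_system gamma T m alpha a n0 Phi_succ /\
  (forall j, (j < n0)%N -> Cinfty T (@Phi_succ R j)).
Proof.
have adec i j : (i <= j)%N -> (j <= m)%N -> alpha j <= alpha i.
  move=> ij; elim: j ij => [|j IH]; first by rewrite leqn0 => /eqP->.
  rewrite leq_eqVlt ltnS => /predU1P[->//|ij] jm.
  exact: le_trans (ltW (halpha_dec _ jm)) (IH ij (ltnW jm)).
(* An index i >= 1 violating the bound would belong to [H_set], since alpha_i >= alpha_m >= 0. *)
have agt i : (i <= m)%N -> n0%:R - 1 < alpha i.
  case: i => [_|i im]; first by case/andP: hn0.
  rewrite ltNge; apply/negP => h.
  suff : H_set m alpha (n0%:R - 1) i.+1 by rewrite hH.
  by split => //; rewrite h andbT (le_trans halpha_ge0) // adec.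
have fo i : (i <= m)%N -> frac_order (alpha i) = n0.
  move=> im; apply: frac_orderE; rewrite agt //=.
  by have /andP[_ h] := hn0; exact: le_trans (adec 0%N i _ im) h.
(* If n0 were 0, then alpha_0 <= 0, against alpha_0 > alpha_1 >= alpha_m >= 0. *)
have n0_gt0 : (0 < n0)%N.
  case: n0 hn0 {hH hgamma agt fo} => // /andP[_ h].
  have := halpha_dec 0%N hm; have := adec 1%N m hm (leqnn m); lra.
case: n0 => [//|n] in hn0 hgamma hH agt fo n0_gt0 *.
pose p : {poly R} := \poly_(k < n.+1) (b k / k`!%:R).
have pE t : p.[t] = \sum_(0 <= k < n.+1) b k * Phi_succ k t.
  exact: horner_Phi_succ.
have Phi_sol (q : {poly R}) : (size q <= n.+1)%N ->
    fde_solution gamma T m alpha a (horner q).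
  by move=> sq; exact: fde_solution_horner fo sq.
split; [|split].
- exists (horner p); split => //.
  + by apply: Phi_sol; exact: size_poly.
  + move=> k kn; have := @init_value_horner R T k p hT.
    by rewrite derivn_horner0 coef_poly kn divfK // fact_unit.
  + move=> z zsol zb t tT; rewrite pE.
    apply: (fde_solution_unique hT hgamma01 (esym hgamma) fo _ _ _ zsol zb tT).
    * move=> i /andP[i1 im]; rewrite adec //=; exact: halpha_dec.
    * by move=> i /andP[_ im]; have := agt i im; rewrite -natr1 addrK.
    (* Membership in C^1_gamma includes continuity of the coefficient on the closed interval, hence
       its boundedness. *)
    * by move=> i im; have [[_ /(_ 0%N isT)]] := ha i im.
- move=> j jn; rewrite Phi_succ_horner; split.
    apply: Phi_sol; apply: leq_trans (size_scale_leq _ _) _.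
    by rewrite size_polyXn.
  move=> k kn; have := @init_value_horner R T k (j`!%:R^-1 *: 'X^j) hT.
  rewrite derivn_horner0 coefZ coefXn; case: eqVneq => [->|_].
    by rewrite mulr1 mulVf // fact_unit.
  by rewrite mulr0 mul0r.
by move=> j jn; rewrite Phi_succ_horner; exact: Cinfty_horner.
Qed.
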